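(* Let $\vec a=(a_0,\dots,a_n)\in\mathbb{Z}^{n+1}$ be an integer vector with amplitude $M:=\max_{0\le i\le n} a_i-\min_{0\le i\le n} a_i$, let $H:=H_{\vec a}$ be its tropical entropy, $d_{\vec a}$ its tropical Hilbert function, and $V$ the number of vertices of the graph $G_{\vec a}$ (defined in the context). Then for $k>(V^2+1)(V+n)+V((1-H)V+n+1)^2$ the tropical Hilbert function fulfils the equality $$d_{\vec a}(k+R)=d_{\vec a}(k)+HR$$ for some positive integer $R<\exp((O(Mn))^n)$.
   Context: A sequence $(z_1,\dots,z_k)\in\mathbb{R}^k$ satisfies $\vec a$ if for every $1\le j\le k-n$ the minimum $\min_{0\le i\le n}\{z_{j+i}+a_i\}$ is attained for at least two different values of $i$. $D(k)\subset\mathbb{R}^k$ denotes the set of all such sequences; it is a finite union of polyhedra. The tropical Hilbert function is $d_{\vec a}(k):=\dim D(k)$ (the maximal dimension of a polyhedron in this union). The tropical entropy is $H_{\vec a}:=\lim_{k\to\infty}d_{\vec a}(k)/k$ (the limit exists by subadditivity of $d_{\vec a}$). Vertices of $G_{\vec a}$. A vertex $v$ is given by: a nonempty set $B\subset\{1,\dots,n\}$; an element $s\in B$; and, for each pair $r<l$ in $B$, an integer $m(r,l)$ and an indicator $e(r,l)\in\{0,1\}$, such that $m(s,q)\ge -nM$ for $q\in B$, $q>s$; $m(p,s)\le (n+s-p)M$ for $p\in B$, $p<s$; $|m(r,l)|\le 2nM$ for all $r<l$ in $B$; and such that the polyhedron $P_v\subset\mathbb{R}^n$ is nonempty, where $P_v$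 is the set of $(y_1,\dots,y_n)$ with - $y_s\le y_j$ for $1\le j\le n$; - $y_r=y_l+m(r,l)$ for $r<l$ in $B$ with $e(r,l)=0$; - $y_r-1<y_l+m(r,l)<y_r$ for $r<l$ in $B$ with $e(r,l)=1$; - $y_j-y_s>jM$ for $1\le j\le n$, $j\notin B$. Here $s$ is the smallest element of $B$ at which the minimum of the coordinates is attained on $P_v$. All such data with $P_v\neq\emptyset$ give the vertices of $G_{\vec a}$; $V$ is their (finite) number.
   Formalization: For a constant vector (M = 0) the bound exp((O(Mn))^n) read literally is exp(0) = 1, which no positive integer R satisfies; the formal statement replaces M by max(M,1) in the bound, which changes nothing when M ≥ 1. *)

(* Defs.v *)
From HB Require Import structures.
From mathcomp Require Import all_boot all_order all_algebra finmap.
From mathcomp Require Import zify.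
From mathcomp Require Import boolp classical_sets functions cardinality reals.
From mathcomp Require Import topology normedtype sequences.
Set Implicit Arguments.
Unset Strict Implicit.
Unset Printing Implicit Defensive.
Import Order.TTheory GRing.Theory Num.Theory.
Import numFieldNormedType.Exports.
Local Open Scope classical_set_scope.
Local Open Scope ring_scope.

Definition amplitude (n : nat) (a : 'I_n.+1 -> int) : int :=
  \big[Num.max/a ord0]_i a i - \big[Num.min/a ord0]_i a i.

(* All indices are 0-based: a sequence (z_1, ..., z_k) is z : 'rV_k with
   z_j = z 0 (j - 1), and the windows are indexed by 'I_(k - n), which is empty
   when k <= n. *)
Lemma window_subproof (n k : nat) (j : 'I_(k - n)) (i : 'I_n.+1) : (j + i < k)%N.
Proof. by have := ltn_ord j; have := ltn_ord i; lia. Qed.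

Definition window (n k : nat) (j : 'I_(k - n)) (i : 'I_n.+1) : 'I_k :=
  Ordinal (window_subproof j i).

Definition min_attained_at (R : realType) (n k : nat) (a : 'I_n.+1 -> int)
    (z : 'rV[R]_k) (j : 'I_(k - n)) (i : 'I_n.+1) : Prop :=
  forall i' : 'I_n.+1,
    z 0 (window j i) + (a i)%:~R <= z 0 (window j i') + (a i')%:~R.

Definition satisfies (R : realType) (n k : nat) (a : 'I_n.+1 -> int)
    (z : 'rV[R]_k) : Prop :=
  forall j : 'I_(k - n), exists i1 i2 : 'I_n.+1,
    [/\ i1 != i2, min_attained_at a z j i1 & min_attained_at a z j i2].

Definition D (R : realType) (n : nat) (a : 'I_n.+1 -> int) (k : nat) :
  set 'rV[R]_k := [set z | satisfies a z].
Arguments D R {n} a k.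

(* The polyhedra whose union is D(k): a choice c fixes, in each window, two
   different places at which the minimum is attained. *)
Definition choice_of_pairs (n k : nat)
    (c : {ffun 'I_(k - n) -> 'I_n.+1 * 'I_n.+1}) : bool :=
  [forall j, (c j).1 != (c j).2].

Definition D_polyhedron (R : realType) (n : nat) (a : 'I_n.+1 -> int) (k : nat)
    (c : {ffun 'I_(k - n) -> 'I_n.+1 * 'I_n.+1}) : set 'rV[R]_k :=
  [set z | forall j, min_attained_at a z j (c j).1 /\
                     min_attained_at a z j (c j).2].
Arguments D_polyhedron R {n} a {k} c.

Lemma D_bigcup (R : realType) (n : nat) (a : 'I_n.+1 -> int) (k : nat) :
  D R a k = \bigcup_(c in [set c | choice_of_pairs c]) D_polyhedron R a c.
Proof.
apply/seteqP; split => [z /= Dz|z [c /= /forallP cP zP] j]; last first.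
  by exists (c j).1, (c j).2; have [] := zP j; split.
have /choice [f fP] : forall j, exists p : 'I_n.+1 * 'I_n.+1,
    [/\ p.1 != p.2, min_attained_at a z j p.1 & min_attained_at a z j p.2].
  by move=> j; have [i1 [i2 ?]] := Dz j; exists (i1, i2).
exists [ffun j => f j] => [|j] /=; last by rewrite ffunE; have [] := fP j.
by apply/forallP => j; rewrite ffunE; have [] := fP j.
Qed.

(* Dimension of the affine hull: the largest d such that S contains d + 1
   affinely independent points x, x + row 0 A, ..., x + row (d - 1) A (and 0
   when S is empty, which does not affect a maximum of dimensions). *)
Definition affine_dim (R : realType) (k : nat) (S : set 'rV[R]_k) : nat :=
  (\max_(d < k.+1 | `[< exists (x : 'rV[R]_k) (A : 'M[R]_(d, k)),
      [/\ S x, forall i, S (x + row i A)%R & row_free A] >]) d)%N.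

Definition hilbert (R : realType) (n : nat) (a : 'I_n.+1 -> int) (k : nat) : nat :=
  (\max_(c : {ffun 'I_(k - n) -> 'I_n.+1 * 'I_n.+1} | choice_of_pairs c)
      affine_dim (D_polyhedron R a c))%N.
Arguments hilbert R {n} a k.

Definition entropy (R : realType) (n : nat) (a : 'I_n.+1 -> int) : R :=
  lim ((fun k : nat => (hilbert R a k)%:R / k%:R : R) @ \oo).
Arguments entropy R {n} a.

(* The element i : 'I_n stands for i.+1 in {1, ..., n}. *)
Definition vertex_polyhedron (R : realType) (n : nat) (a : 'I_n.+1 -> int)
    (B : {set 'I_n}) (s : 'I_n) (m : 'M[int]_n) (e : 'M[bool]_n) :
    set 'rV[R]_n :=
  [set y |
    [/\ forall j, y 0 s <= y 0 j,
        forall r l, r \in B -> l \in B -> (r < l)%N -> e r l = false ->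
          y 0 r = y 0 l + (m r l)%:~R,
        forall r l, r \in B -> l \in B -> (r < l)%N -> e r l = true ->
          y 0 r - 1 < y 0 l + (m r l)%:~R < y 0 r
      & forall j, j \notin B -> y 0 j - y 0 s > (j.+1%:Z * amplitude a)%:~R]].
Arguments vertex_polyhedron R {n} a B s m e.

(* The data m(r, l) and e(r, l) only make sense for r < l in B; the remaining
   entries of the matrices m and e are set to 0 and false, so that a vertex is
   represented by exactly one quadruple. The last clause says that s is the
   smallest index at which the minimum of the coordinates is attained: indices
   j outside B are excluded by y_j - y_s > j M >= 0. *)
Definition is_vertex (R : realType) (n : nat) (a : 'I_n.+1 -> int)
    (B : {set 'I_n}) (s : 'I_n) (m : 'M[int]_n) (e : 'M[bool]_n) : Prop :=
  let M := amplitude a in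
  let P := vertex_polyhedron R a B s m e in
  [/\ s \in B,
      forall r l, ~~ [&& r \in B, l \in B & (r < l)%N] ->
        m r l = 0 /\ e r l = false,
      [/\ forall q, q \in B -> (s < q)%N -> m s q >= - (n%:Z * M),
          forall p, p \in B -> (p < s)%N -> m p s <= (n%:Z + s%:Z - p%:Z) * M
        & forall r l, r \in B -> l \in B -> (r < l)%N ->
            `|m r l| <= 2 * n%:Z * M],
      P !=set0
    & forall y, P y -> forall p, p \in B -> (p < s)%N -> y 0 s < y 0 p].
Arguments is_vertex R {n} a B s m e.

Definition vertices (R : realType) (n : nat) (a : 'I_n.+1 -> int) :
    set ({set 'I_n} * 'I_n * 'M[int]_n * 'M[bool]_n) :=
  [set v | is_vertex R a v.1.1.1 v.1.1.2 v.1.2 v.2].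
Arguments vertices R {n} a.

Lemma amplitude_ge0 (n : nat) (a : 'I_n.+1 -> int) : 0 <= amplitude a.
Proof.
rewrite subr_ge0 (@le_trans _ _ (a ord0)) //.
  exact: bigmin_le_id.
exact: bigmax_ge_id.
Qed.

Lemma vertices_finite (R : realType) (n : nat) (a : 'I_n.+1 -> int) :
  finite_set (vertices R a).
Proof.
pose K := (2 * n * absz (amplitude a))%N.
pose T : finType := ({set 'I_n} * 'I_n * 'M['I_(2 * K).+1]_n * 'M[bool]_n)%type.
pose f (t : T) : {set 'I_n} * 'I_n * 'M[int]_n * 'M[bool]_n :=
  (t.1.1.1, t.1.1.2, map_mx (fun o : 'I__ => o%:Z - K%:Z) t.1.2, t.2).
apply: (@sub_finite_set _ _ (f @` [set: T])); last first.
  exact/finite_image/finite_finset.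
move=> [[[B s] m] e] [/= sB m0 [_ _ mK] _ _].
exists (B, s, map_mx (fun z : int => inord (absz (z + K%:Z))) m, e) => //.
rewrite /f /=; congr (_, _, _, _); apply/matrixP => r l; rewrite !mxE.
have : `|m r l| <= K%:Z.
  have [/and3P[rB lB rl]|nrl] := boolP [&& r \in B, l \in B & (r < l)%N].
    apply: le_trans (mK _ _ rB lB rl) _.
    by have := amplitude_ge0 a; rewrite /K; nia.
  by have [-> _] := m0 _ _ nrl; rewrite normr0.
by move=> mrl; rewrite inordK; lia.
Qed.

Definition nb_vertices (R : realType) (n : nat) (a : 'I_n.+1 -> int) : nat :=
  #|` fset_set (vertices R a)|%fset.
Arguments nb_vertices R {n} a.

(* Main.v *)
Require Import Defs.
From mathcomp Require Import all_boot all_order all_algebra.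
From mathcomp Require Import finmap zify ring lra.
From mathcomp Require Import boolp reals sequences.
Set Implicit Arguments.
Unset Strict Implicit.
Unset Printing Implicit Defensive.
Import Order.TTheory GRing.Theory Num.Theory.

(** The polyhedra of D(k) are cut out by inequalities between differences of
    coordinates and integers, so d(k) is the largest number of classes modulo 1
    among the entries of a sequence satisfying a. What a sequence can be
    continued by depends only on the cell, in the arrangement y_r - y_l in Z, of
    those among its last n entries that are close to their minimum; these cells
    are vertices of the graph. Hence d(k) is the maximal weight of a walk of
    length k - n, each step weighing 1 if it creates a new class and 0 otherwise.

    Let H be the maximal mean of a cycle. A long optimal walk meets a cycle of
    mean H: otherwise each closed subwalk loses at least 1/V^2 per step against
    H. Closed subwalks whose total length is divisible by the length l of that
    cycle can be traded for turns around the cycle without loss of weight, so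
    d(k + R) = d(k) + H R as soon as R is divisible by one length l for each
    class of vertices lying on common cycles of mean H. These lengths add up to
    at most V, so they take O(sqrt V) values and their product is
    V^O(sqrt V). As V = O(M n^2)^n, this is smaller than exp((O(M n))^n),
    whereas the least common multiple of 1, ..., V would not be. *)

(** * Walks of maximal weight in a finite digraph *)

(** Room for the walk assembled in [transfer]: [a] and [b] are its shortened ends, [x] and [y] the
    ways to and from a cycle of length [l], travelled [l] times. *)
Lemma detour_bound N l L a b x y : l <= N -> 4 * N ^ 2 <= L ->
  a < N * l -> b < N * l -> x < N -> y < N -> a + b + l * (x + y) <= L.
Proof.
move=> lN hL ha hb hx hy; apply: leq_trans hL.
have : l * (x + y) <= N * (N + N) by rewrite leq_mul // leq_add // ltnW.
have : N * l <= N * N by rewrite leq_mul2l lN orbT.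
rewrite expnS expn1; lia.
Qed.

(** The [l] round trips of length [x + y] vanish modulo [l], so what is missing to [L] is a whole
    number of turns of length [l]. *)
Lemma padded_length l L a b x y : 0 < l -> a + b + l * (x + y) <= L -> L = a + b %[mod l] ->
  a + (l.-1 * (x + y) + (x + ((L - (a + b + l * (x + y))) %/ l * l + (y + b)))) = L.
Proof.
case: l => // l _ hb eL; rewrite divnK; first by rewrite mulSn in hb *; lia.
by rewrite -eqn_mod_dvd // eL [in eqbRHS]addnC mulnC modnMDl.
Qed.

Section Walks.
Variables (S : finType) (E : rel S) (w : S -> S -> bool).

Fixpoint wt (u : S) (p : seq S) : nat :=
  if p is v :: p' then w u v + wt v p' else 0.

Lemma wt_cat u p q : wt u (p ++ q) = wt u p + wt (last u p) q.
Proof. by elim: p u => //= v p IH u; rewrite IH addnA. Qed.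

Lemma wt_size u p : wt u p <= size p.
Proof. by elim: p u => //= v p IH u; have := IH v; have := leq_b1 (w u v); lia. Qed.

(** Pigeonhole on the pairs (vertex reached after [i] steps, [i] modulo [m]). *)
Lemma split_walk m (u : S) p : 0 < m -> #|S| * m <= size p ->
  exists p1 p2 p3, [/\ p = p1 ++ p2 ++ p3, 0 < size p2,
    last (last u p1) p2 = last u p1 & m %| size p2].
Proof.
case: m => // m _ hp.
pose f (i : 'I_(size p).+1) : S * 'I_m.+1 := (last u (take i p), inord (i %% m.+1)).
have /injectivePn[i [j ij fij]] : ~~ injectiveb f.
  apply/negP => /injectiveP /leq_card; rewrite card_prod !card_ord; lia.
wlog lij : i j ij fij / i < j.
  move=> H; case: (ltngtP i j) => [|ji|/val_inj eij].
  - exact: H.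
  - by apply: (H j i) => //; rewrite eq_sym.
  - by rewrite eij eqxx in ij.
case: fij => e1 /(congr1 val); rewrite /= !inordK ?ltn_pmod // => e2.
have ltj := ltn_ord j.
exists (take i p), (drop i (take j p)), (drop j p); split.
- by rewrite catA -{1}(take_takel p (ltnW lij)) !cat_take_drop.
- by rewrite size_drop size_takel; lia.
- by rewrite [in RHS]e1 -last_cat -{1}(take_takel p (ltnW lij)) cat_take_drop.
- rewrite size_drop size_takel; last lia.
  by rewrite -(eqn_mod_dvd _ (ltnW lij)) e2.
Qed.

Lemma split_short_walk (u : S) p : #|S| <= size p ->
  exists p1 p2 p3, [/\ p = p1 ++ p2 ++ p3, 0 < size p2, size p2 <= #|S|
    & last (last u p1) p2 = last u p1].
Proof.
move=> hp.
have [||p1 [p2 [p3 [e h2 h3 _]]]] := @split_walk 1 u (take #|S| p) => //.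
  by rewrite size_takel ?muln1.
exists p1, p2, (p3 ++ drop #|S| p); split => //.
  by rewrite -[p in LHS](cat_take_drop #|S|) e -!catA.
have := congr1 size e; rewrite size_takel // !size_cat; lia.
Qed.

Definition rep q (c : seq S) := flatten (nseq q c).

Lemma rep_path q u c : path E u c -> last u c = u ->
  path E u (rep q c) /\ last u (rep q c) = u.
Proof.
move=> pc lc; elim: q => //= q [IH1 IH2].
by rewrite /rep /= cat_path last_cat lc pc.
Qed.

Lemma size_rep q c : size (rep q c) = q * size c.
Proof. by elim: q => //= q IH; rewrite /rep /= size_cat -/(rep q c) IH. Qed.

(** * Closed walks of maximal mean and the exchange of closed subwalks *)

Section Excess.
Variables l0 w0 : nat.
Local Open Scope ring_scope.

(* The excess of a walk over the mean [w0 / l0]. *)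
Definition xs (u : S) (p : seq S) : int := (l0 * wt u p)%:Z - (w0 * size p)%:Z.

Lemma xs_nil u : xs u [::] = 0.
Proof. by rewrite /xs /=; lia. Qed.

Lemma xs_cat u p q : xs u (p ++ q) = xs u p + xs (last u p) q.
Proof. by rewrite /xs wt_cat size_cat; lia. Qed.

Lemma xs_rep q u c : last u c = u -> xs u (rep q c) = q%:Z * xs u c.
Proof.
move=> lc; elim: q => [|q IH]; first by rewrite xs_nil mul0r.
by rewrite /rep /= xs_cat lc -/(rep q c) IH; lia.
Qed.

Lemma xs_le u p : (w0 <= l0)%N -> xs u p <= ((l0 - w0) * size p)%:Z.
Proof.
move=> w0_le; rewrite /xs; have := wt_size u p => h.
have : (l0 * wt u p <= l0 * size p)%N by rewrite leq_mul2l h orbT.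
nia.
Qed.

Hypothesis xs_closed : forall u p, path E u p -> last u p = u -> xs u p <= 0.

(** Closed subwalks of length divisible by [m] are cut out; their excess is at most 0, so nothing is
    lost. *)
Lemma reduce m u p : (0 < m)%N -> path E u p ->
  exists p', [/\ path E u p', last u p' = last u p, (size p' < #|S| * m)%N,
    size p' = size p %[mod m] & xs u p <= xs u p'].
Proof.
move=> m0; have [k] := ubnP (size p); elim: k p => // k IH p hk pp.
have [hp|hp] := ltnP (size p) (#|S| * m); first by exists p; split.
have [p1 [p2 [p3 [e h2 h3 h4]]]] := split_walk u m0 hp.
move: pp hk; rewrite e !cat_path !size_cat => /and3P[e1 e2 e3] hk.
case: (IH (p1 ++ p3)).
- by rewrite size_cat; lia.
- by rewrite cat_path e1 -h3.
move=> p' [a1 a2 a3 a4 a5]; exists p'; split => //.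
- by rewrite a2 !last_cat h3.
- rewrite a4 size_cat; move/dvdnP: h4 => [q ->].
  by rewrite addnCA modnMDl.
- apply: le_trans a5; rewrite !xs_cat h3.
  by have := xs_closed e2 h3; lia.
Qed.

(** The critical vertices of max-plus spectral theory, once [w0 / l0] is the maximal cycle mean. *)
Definition crit u : Prop := exists p, [/\ path E u p, last u p = u, (0 < size p)%N & xs u p = 0].

(** Away from critical vertices a closed subwalk of length at most [#|S|] has negative integer
    excess, hence at most -1. Removing it does not decrease the left-hand side, and a remainder
    shorter than [#|S|] satisfies the bound by [xs_le]. *)
Lemma noncrit_xs u p : (w0 <= l0)%N -> path E u p -> (forall v, v \in u :: p -> ~ crit v) ->
  #|S|%:Z * xs u p + (size p)%:Z <= #|S|%:Z * ((l0 - w0) * #|S|)%:Z + #|S|%:Z.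
Proof.
move=> w0_le; have [k] := ubnP (size p); elim: k p => // k IH p hk pp nc.
have [hp|hp] := ltnP (size p) #|S|.
  have h1 := xs_le u p w0_le.
  have h2 : ((l0 - w0) * size p <= (l0 - w0) * #|S|)%N by rewrite leq_mul2l (ltnW hp) orbT.
  have : xs u p <= ((l0 - w0) * #|S|)%:Z by lia.
  move=> h; have := ler_wpM2l (_ : 0 <= #|S|%:Z) h; lia.
have [p1 [p2 [p3 [e h2 h3 h4]]]] := split_short_walk u hp.
move: pp hk nc; rewrite e !cat_path !size_cat => /and3P[e1 e2 e3] hk nc.
have x2 : xs (last u p1) p2 <= -1.
  have := xs_closed e2 h4; suff : xs (last u p1) p2 <> 0 by lia.
  move=> x0; apply: (nc (last u p1)); last by exists p2.
  have := mem_last u p1; rewrite !inE mem_cat => /orP[->//|->]; by rewrite orbT.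
rewrite h4 in e3; have := IH (p1 ++ p3); rewrite size_cat !xs_cat h4 cat_path e1 e3.
have sub : forall v, v \in u :: p1 ++ p3 -> ~ crit v.
  by move=> v; rewrite inE mem_cat => hv; apply: nc; rewrite inE !mem_cat;
    case/or3P: hv => ->; rewrite ?orbT.
have hs : (size p1 + size p3 < k)%N by lia.
move=> /(_ hs isT sub); have := ler_wpM2l (_ : 0 <= #|S|%:Z) x2 => /(_ isT).
rewrite !mulrDr; lia.
Qed.

Lemma chunks L m : (forall u p, path E u p -> size p = L -> xs u p <= -1) ->
  forall u p, path E u p -> size p = (m * L)%N -> xs u p <= - m%:Z.
Proof.
move=> H; elim: m => [|m IH] u p pp sp.
  by rewrite mul0n in sp; rewrite (size0nil sp) xs_nil.
have hL : (L <= size p)%N by rewrite sp; lia.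
move: pp; rewrite -(cat_take_drop L p) cat_path xs_cat => /andP[h1 h2].
have := H _ _ h1; rewrite size_takel // => /(_ erefl).
have := IH _ _ h2; rewrite size_drop sp => /(_ _).
have -> : ((m.+1 * L - L)%N = (m * L)%N) by lia.
move=> /(_ erefl); lia.
Qed.

(** [L] turns around [c] have excess 0 and are also [size c] consecutive walks of length [L]; these
    cannot all have negative excess. *)
Lemma walk_ge0 L u0 c : path E u0 c -> last u0 c = u0 -> (0 < size c)%N ->
  xs u0 c = 0 -> exists u p, [/\ path E u p, size p = L & 0 <= xs u p].
Proof.
move=> pc lc sc xc; apply: contrapT => H.
have [] := rep_path L pc lc => p1 p2.
have := @chunks L (size c) _ u0 (rep L c) p1; rewrite size_rep mulnC xs_rep // xc.
suff h : forall u p, path E u p -> size p = L -> xs u p <= -1.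
  by move=> /(_ h erefl); lia.
move=> u p pp sp; rewrite leNgt; apply/negP => x0.
by apply: H; exists u, p; split => //; lia.
Qed.

(** Its classes are the strong components of the critical graph. *)
Definition crel u v : Prop := exists p q, [/\ path E u p /\ last u p = v,
  path E v q /\ last v q = u, (0 < size (p ++ q))%N & xs u p + xs v q = 0].

Lemma crel_refl u : crit u -> crel u u.
Proof.
by move=> [p [h1 h2 h3 h4]]; exists p, [::]; rewrite cats0 xs_nil addr0.
Qed.

Lemma crel_sym u v : crel u v -> crel v u.
Proof.
move=> [p [q [h1 h2 h3 h4]]]; exists q, p; split => //.
  by rewrite size_cat addnC -size_cat.
by rewrite addrC.
Qed.

Lemma crel_trans v u x : crel u v -> crel v x -> crel u x.
Proof.
move=> [p [q [[p1 p2] [q1 q2] h3 h4]]] [r [s [[r1 r2] [s1 s2] t3 t4]]].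
exists (p ++ r), (s ++ q); rewrite !cat_path !last_cat !xs_cat p2 s2 r2 q2.
rewrite p1 q1 r1 s1; split=> //; first by move: h3; rewrite !size_cat; lia.
by lia.
Qed.

Lemma crit_cycle u : crit u -> exists p, [/\ path E u p, last u p = u,
  (0 < size p)%N, xs u p = 0 & forall q, path E u q -> last u q = u ->
    (0 < size q)%N -> xs u q = 0 -> (size p <= size q)%N].
Proof.
move=> cu.
pose P l := `[< exists p, [/\ path E u p, last u p = u, (0 < size p)%N & xs u p = 0 /\ size p = l] >].
have exP : exists l, P l.
  by case: cu => p [h1 h2 h3 h4]; exists (size p); apply/asboolP; exists p.
case: (ex_minnP exP) => l /asboolP[p [h1 h2 h3 [h4 h5]]] hm.
exists p; split => // q q1 q2 q3 q4; rewrite h5; apply: hm; apply/asboolP.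
by exists q.
Qed.

Definition cycle_at u : seq S :=
  if pselect (crit u) is left cu then projT1 (cid (crit_cycle cu)) else [::].

(** A repeated vertex would split this shortest walk into two closed walks. Their excesses are at
    most 0 with sum 0, so both vanish, and the outer one contradicts minimality. *)
Lemma cycle_atP u : crit u -> let p := cycle_at u in
  [/\ path E u p, last u p = u, (0 < size p)%N, xs u p = 0 & uniq p].
Proof.
move=> cu; rewrite /cycle_at; case: pselect => // {}cu.
case: cid => p [h1 h2 h3 h4 h5] /=; split=> //.
apply: contrapT => /negP/(uniqPn u)[i [j [ij jp eij]]].
pose p1 := take i.+1 p; pose p2 := drop i.+1 (take j.+1 p); pose p3 := drop j.+1 p.
have ep : p = p1 ++ p2 ++ p3.
  rewrite /p1 /p2 /p3 catA -{1}(@take_takel _ i.+1 j.+1 p); last by lia.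
  by rewrite !cat_take_drop.
have lastE k : (k < size p)%N -> last u (take k.+1 p) = nth u p k.
  by move=> kp; rewrite (last_nth u) size_takel // /= nth_take.
have l1 : last u p1 = nth u p i by rewrite /p1 lastE // (ltn_trans ij).
have l2 : last (last u p1) p2 = last u p1.
  rewrite -last_cat /p1 /p2 -{1}(@take_takel _ i.+1 j.+1 p); last by lia.
  by rewrite cat_take_drop lastE // -eij -l1.
have s2 : (0 < size p2)%N by rewrite size_drop size_takel //; lia.
have s1 : (0 < size p1)%N by rewrite size_takel //; exact: ltn_trans ij jp.
move: h1 h2 h4; rewrite ep !cat_path !last_cat !xs_cat => /and3P[q1 q2 q3] e2 e4.
have x2 := xs_closed q2 l2.
have c13 : path E u (p1 ++ p3) by rewrite cat_path q1 -l2.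
have e13 : last u (p1 ++ p3) = u by rewrite last_cat -l2.
have x13 := xs_closed c13 e13.
have z13 : xs u (p1 ++ p3) = 0 by move: x13; rewrite xs_cat; rewrite l2 in e4; lia.
have s13 : (0 < size (p1 ++ p3))%N by rewrite size_cat; lia.
have := h5 _ c13 e13 s13 z13.
have := congr1 size ep; rewrite !size_cat; lia.
Qed.

Definition crclass u : {set S} := [set v | `[< crel u v >]].

Lemma crclassE u v : crel u v -> crclass u = crclass v.
Proof.
move=> uv; apply/setP => x; rewrite !inE; apply/asboolP/asboolP => h.
  exact: crel_trans (crel_sym uv) h.
exact: crel_trans uv h.
Qed.

Lemma size_cycle_at u : crit u -> (size (cycle_at u) <= #|crclass u|)%N.
Proof.
move=> cu; have [h1 h2 h3 h4 h5] := cycle_atP cu.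
rewrite -(card_uniqP h5); apply: subset_leq_card; apply/subsetP => v.
rewrite inE => /splitPr vp; apply/asboolP; case: vp h1 h2 h3 h4 => p1 p2.
rewrite cat_path last_cat /= => /and3P[a1 a2 a3] a4 a5 a6.
exists (rcons p1 v), p2; rewrite rcons_path last_rcons a1 a2 a3; split=> //.
  by rewrite cat_rcons.
by move: a6; rewrite -cat_rcons xs_cat last_rcons.
Qed.

Definition crclasses : {set {set S}} := [set crclass u | u in [pred u | `[< crit u >]]].

(** One representative is chosen per class, so that the length depends on the class only. *)
Definition cycle_len (X : {set S}) : nat :=
  if pselect (exists u, crit u /\ X = crclass u) is left h
  then size (cycle_at (projT1 (cid h))) else 0.

Lemma cycle_lenP X : X \in crclasses -> exists u,
  [/\ crit u, X = crclass u & cycle_len X = size (cycle_at u)].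
Proof.
move=> /imsetP[u /asboolP cu ->]; rewrite /cycle_len.
case: pselect => [h|[]]; last by exists u.
by case: cid => v [cv ev] /=; exists v.
Qed.

Lemma cycle_len_bound X : X \in crclasses ->
  (0 < cycle_len X)%N /\ (cycle_len X <= #|X|)%N.
Proof.
move=> /cycle_lenP[u [cu -> ->]]; split; last exact: size_cycle_at.
by have [] := cycle_atP cu.
Qed.

Definition cycle_lens : {set 'I_#|S|.+1} := [set inord (cycle_len X) | X in crclasses].

(* The sizes of the classes sum up to at most [#|S|], hence so do the distinct
   values of [cycle_len]; this is what makes the product below much smaller
   than the least common multiple of [1, ..., #|S|]. *)
Definition period : nat := (\prod_(q in cycle_lens) q)%N.

Lemma cycle_len_period X : X \in crclasses -> (cycle_len X %| period)%N.
Proof.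
move=> XP; have [h1 h2] := cycle_len_bound XP.
have h : (cycle_len X < #|S|.+1)%N by rewrite ltnS (leq_trans h2) // max_card.
have hin : inord (cycle_len X) \in cycle_lens by apply/imsetP; exists X.
by rewrite /period (bigD1 _ hin) /= inordK // dvdn_mulr.
Qed.

Lemma crclasses_triv : trivIset crclasses.
Proof.
apply/trivIsetP => A B /imsetP[u cu ->] /imsetP[v cv ->] neq.
rewrite -setI_eq0; apply/eqP/setP => x; rewrite !inE; apply/negP.
move=> /andP[/asboolP ux /asboolP vx]; case/eqP: neq.
by rewrite (crclassE ux) (crclassE vx).
Qed.

Lemma sum_cycle_lens : (\sum_(q in cycle_lens) q <= #|S|)%N.
Proof.
apply: (@leq_trans (\sum_(X in crclasses) #|X|)); last first.
  by have /eqP -> := crclasses_triv; exact: max_card.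
(* Classes are grouped by the length of their cycle; a single class of each group already has that
   many elements. *)
rewrite (partition_big_imset (fun X => inord (cycle_len X) : 'I_#|S|.+1)) /=.
apply: leq_sum => q /imsetP[X XP ->]; rewrite (bigD1 X) /=; last by rewrite XP eqxx.
have [h1 h2] := cycle_len_bound XP.
have h : (cycle_len X < #|S|.+1)%N by rewrite ltnS (leq_trans h2) // max_card.
by rewrite inordK //; lia.
Qed.

Lemma cycle_lens_gt0 q : q \in cycle_lens -> (0 < q)%N.
Proof.
move=> /imsetP[X XP ->]; have [h1 h2] := cycle_len_bound XP.
by rewrite inordK // ltnS (leq_trans h2) // max_card.
Qed.

Lemma period_gt0 : (0 < period)%N.
Proof. by rewrite prodn_cond_gt0 // => q; exact: cycle_lens_gt0. Qed.

(** At most [K] lengths are [<= K]. Those above [K] sum to at most [K ^ 2], so there are at most [K]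
    of them too. *)
Lemma card_cycle_lens K : (#|S| <= K ^ 2)%N -> (0 < K)%N -> (#|cycle_lens| <= 2 * K)%N.
Proof.
move=> hK K0; rewrite -(cardsID [set q : 'I__ | (q <= K)%N] cycle_lens) mul2n -addnn.
apply: leq_add.
  have h : {subset cycle_lens :&: [set q : 'I__ | (q <= K)%N] <=
      [set (inord i.+1 : 'I_#|S|.+1) | i : 'I_K]}.
    move=> q; rewrite !inE => /andP[/cycle_lens_gt0 q0 qK].
    have h : (q.-1 < K)%N by lia.
    by apply/imsetP; exists (Ordinal h) => //=; rewrite prednK // inord_val.
  apply: leq_trans (subset_leq_card (introT subsetP h)) _.
  by rewrite -[leqRHS]card_ord; exact: leq_imset_card.
rewrite -(leq_pmul2r K0) -[leqRHS]/(K ^ 2)%N.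
apply: leq_trans hK; apply: leq_trans sum_cycle_lens.
rewrite -sum_nat_const (big_setID [set q : 'I__ | (q <= K)%N] (A := cycle_lens)) /=.
apply: leq_trans (leq_addl _ _); apply: leq_sum => q; rewrite !inE => /andP[]; lia.
Qed.

Lemma period_le K : (#|S| <= K ^ 2)%N -> (0 < K)%N -> (period <= #|S|.+1 ^ (2 * K))%N.
Proof.
move=> hK K0; apply: (@leq_trans (#|S|.+1 ^ #|cycle_lens|)); last first.
  by rewrite leq_pexp2l // card_cycle_lens.
by rewrite -prod_nat_const; apply: leq_prod => q _; exact: ltnW.
Qed.

(** The parts of [p] before and after [v] are shortened modulo [l], the length of the cycle chosen
    in the class of [v], and turns around that cycle restore the length. Only divisibility of
    [period] by this one [l] is called for. *)
Lemma transfer u p L : path E u p -> (exists2 v, v \in u :: p & crit v) ->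
  (4 * #|S| ^ 2 <= L)%N -> L = size p %[mod period] ->
  exists p', [/\ path E u p', size p' = L & xs u p <= xs u p'].
Proof.
move=> pp [v vp cv] hL eL.
have [p1 [p2 [ep lp1]]] : exists p1 p2, p = p1 ++ p2 /\ last u p1 = v.
  by case/splitPl: vp => p1 p2 e; exists p1, p2.
have XP : crclass v \in crclasses by apply/imsetP; exists v => //; apply/asboolP.
have [r [cr er lr]] := cycle_lenP XP.
have vr : crel v r.
  have : r \in crclass v by rewrite er inE; apply/asboolP/crel_refl.
  by rewrite inE => /asboolP.
have [c1 c2 c3 c4 _] := cycle_atP cr; set c := cycle_at r in lr c1 c2 c3 c4.
set l := size c in c3 lr.
have hl : (l <= #|S|)%N by rewrite -lr (leq_trans (cycle_len_bound XP).2) // max_card.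
have {}eL : L = size p %[mod l].
  by have := cycle_len_period XP; rewrite lr => d; rewrite -(modn_dvdm L d) eL modn_dvdm.
move: pp eL; rewrite ep cat_path lp1 => /andP[pp1 pp2] eL.
have [p1' [a1 a2 a3 a4 a5]] := reduce c3 pp1.
have [p2' [b1 b2 b3 b4 b5]] := reduce c3 pp2.
have [x [y [[x1 x2] [y1 y2] _ xy]]] := vr.
(* Modulus 1: any closed subwalk may go, which makes the connecting paths shorter than [#|S|]. *)
have [x' [x3 x4 x5 _ x6]] := reduce (ltnSn 0) x1.
have [y' [y3 y4 y5 _ y6]] := reduce (ltnSn 0) y1.
rewrite !muln1 in x5 y5; rewrite x2 in x4; rewrite y2 in y4; rewrite lp1 in a2.
have xy1 : path E v (x' ++ y') by rewrite cat_path x3 x4.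
have xy2 : last v (x' ++ y') = v by rewrite last_cat x4.
have [d1 d2] := rep_path l.-1 xy1 xy2.
pose q := ((L - (size p1' + size p2' + l * (size x' + size y'))) %/ l)%N.
have [r1 r2] := rep_path q c1 c2.
(* The last of the [l] round trips from [v] to [r] is opened at [r] to insert the [q] turns. *)
exists (p1' ++ rep l.-1 (x' ++ y') ++ x' ++ rep q c ++ y' ++ p2').
rewrite !cat_path a1 a2 d1 d2 x3 x4 r1 r2 y3 y4 b1; split=> //.
  rewrite !size_cat !size_rep size_cat -/l.
  apply: padded_length => //; first exact: (@detour_bound #|S|).
  by rewrite eL size_cat -(modnDml (size p1)) -(modnDmr _ (size p2)) -a4 -b4 modnDml modnDmr.
rewrite !xs_cat a2 d2 x4 r2 y4 lp1 !xs_rep // c4.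
have h : 0 <= xs v x' + xs r y' by rewrite -xy lerD.
have {h} : 0 <= (l.-1.+1)%:Z * (xs v x' + xs r y') by rewrite mulr_ge0.
rewrite -addn1 PoszD mulrDl mul1r.
move: a5 b5; rewrite mulr0 xs_cat x4; generalize (l.-1%:Z * (xs v x' + xs r y')) => A.
clear; lia.
Qed.

End Excess.

Lemma closed_walk_exists : (exists u p, path E u p /\ #|S| <= size p) ->
  exists u p, [/\ path E u p, last u p = u, 0 < size p & size p <= #|S|].
Proof.
move=> [u [p [pp hp]]]; have [p1 [p2 [p3 [e h2 h3 h4]]]] := split_short_walk u hp.
exists (last u p1), p2; split=> //.
by move: pp; rewrite e !cat_path => /and3P[].
Qed.

(** Closed walks of length at most [#|S|] realise finitely many pairs (length, weight), so a best
    mean exists among them. Longer closed walks decompose into shorter ones and cannot beat it. *)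
Lemma best_mean : (exists u p, path E u p /\ #|S| <= size p) ->
  exists l0 w0, [/\ 0 < l0 <= #|S|, w0 <= l0,
    forall u p, path E u p -> last u p = u -> (xs l0 w0 u p <= 0)%R &
    exists u c, [/\ path E u c, last u c = u, 0 < size c & xs l0 w0 u c = 0%R]].
Proof.
move=> /closed_walk_exists[u0 [p0 [a1 a2 a3 a4]]].
pose P (c : 'I_#|S|.+1 * 'I_#|S|.+1) := `[< exists u p,
  [/\ path E u p, last u p = u, 0 < size p & size p = c.1 /\ wt u p = c.2] >].
pose F (c : 'I_#|S|.+1 * 'I_#|S|.+1) : rat := (c.2%:R / c.1%:R)%R.
have mkP u p : path E u p -> last u p = u -> 0 < size p -> size p <= #|S| ->
    P (inord (size p), inord (wt u p)).
  move=> h1 h2 h3 h4; apply/asboolP; exists u, p; split=> //.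
  by rewrite /= !inordK // ltnS ?(leq_trans (wt_size u p)).
case: (@Order.TotalTheory.arg_maxP _ _ _ (inord (size p0), inord (wt u0 p0)) P F (mkP _ _ a1 a2 a3 a4)).
move=> [l0 w0] /asboolP[u1 [p1 [b1 b2 b3 [b4 b5]]]] hmax; rewrite /= in b4 b5.
have l0_gt0 : 0 < l0 by rewrite -b4.
exists l0, w0; split.
- by rewrite l0_gt0 -ltnS ltn_ord.
- by rewrite -b4 -b5 wt_size.
- move=> u p; have [k] := ubnP (size p); elim: k u p => // k IH u p hk pp lp.
  have [hp|hp] := leqP (size p) #|S|.
    case: p hk pp lp hp => [|v p] hk pp lp hp; first by rewrite xs_nil.
    set q := v :: p in hk pp lp hp *.
    have := hmax _ (mkP u q pp lp isT hp); rewrite /F /= !inordK //; last first.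
      by rewrite ltnS (leq_trans (wt_size u q)).
    rewrite ler_pdivrMr ?ltr0n // mulrAC ler_pdivlMr ?ltr0n // -!natrM ler_nat.
    by rewrite /xs subr_le0 lez_nat mulnC.
  have [q1 [q2 [q3 [e h2 h3 h4]]]] := split_short_walk u (ltnW hp).
  move: pp lp hk hp; rewrite e !cat_path !last_cat !size_cat => /and3P[c1 c2 c3] lp hk hp.
  have x2 := IH _ q2 (_ : size q2 < k) c2 h4.
  have x13 := IH u (q1 ++ q3); rewrite size_cat cat_path last_cat xs_cat in x13.
  rewrite h4 in c3 lp; rewrite c1 c3 in x13.
  have := x2 ltac:(lia); have := x13 ltac:(lia) isT lp.
  rewrite !xs_cat h4; lia.
- by exists u1, p1; split=> //; rewrite /xs b4 b5 mulnC subrr.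
Qed.

(** Here [r0] accounts for the initial window. The last equality results from transferring an
    optimal walk of length [L] to length [L + per], and one of length [L + per] back to [L]. *)
Theorem walk_periodicity (d : nat -> nat) (r0 : S -> nat) (n : nat) :
  (forall u, r0 u <= n) -> (forall u v, E u v -> 0 < r0 u) ->
  (forall u p, path E u p -> 0 < size p -> r0 u + wt u p <= d (size p)) ->
  (forall L, exists u p, [/\ path E u p, size p = L & d L = r0 u + wt u p]) ->
  exists l0 w0 per, [/\ 0 < l0, w0 <= l0, 0 < per &
   [/\ forall K, #|S| <= K ^ 2 -> 0 < K -> per <= #|S|.+1 ^ (2 * K),
       forall L, 0 < L -> w0 * L <= l0 * d L <= w0 * L + l0 * (n + #|S|) &
       forall L, 4 * #|S| ^ 2 <= L -> #|S| ^ 2 * (#|S| + n) < L ->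
         l0 * d (L + per) = l0 * d L + w0 * per]].
Proof.
move=> r0_le r0_gt0 d_ub d_att.
have [|l0 [w0 [/andP[l0_gt0 l0_le] w0_le xs_closed [u0 [c [c1 c2 c3 c4]]]]]] := best_mean.
  by have [u [p [h1 h2 _]]] := d_att #|S|; exists u, p; rewrite h1 h2.
have pgt0 := period_gt0 xs_closed.
(* Some walk of length [L] has excess at least 0; the extra [l0] comes from [r0 u] being
   positive. *)
have dlow L : 0 < L -> w0 * L + l0 <= l0 * d L.
  move=> L0; have [u [p [p1 p2 p3]]] := walk_ge0 L c1 c2 c3 c4.
  have := d_ub u p p1; rewrite p2 => /(_ L0) h.
  have r1 : 0 < r0 u by case: p p1 p2 {p3 h} L0 => [_ <-//|v p /= /andP[/r0_gt0]].
  have : l0 * (r0 u + wt u p) <= l0 * d L by rewrite leq_mul2l h orbT.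
  have : l0 * 1 <= l0 * r0 u by rewrite leq_mul2l r1 orbT.
  rewrite mulnDr; move: p3; rewrite /xs p2; lia.
(* By [dlow] an optimal walk has excess at least [l0 - l0 * n]; if it avoided critical vertices,
   [noncrit_xs] would bound its length by the threshold. *)
have visit L u p : path E u p -> size p = L -> d L = r0 u + wt u p ->
    #|S| ^ 2 * (#|S| + n) < L -> exists2 v, v \in u :: p & crit l0 w0 v.
  move=> pp sp dp hL; apply: contrapT => H.
  have nc v : v \in u :: p -> ~ crit l0 w0 v by move=> vp cv; apply: H; exists v.
  have := noncrit_xs xs_closed w0_le pp nc; rewrite sp.
  have x1 : (xs l0 w0 u p + (l0 * n)%:Z >= l0%:Z)%R.
    have := dlow L (leq_ltn_trans (leq0n _) hL); rewrite dp mulnDr /xs sp.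
    have : l0 * r0 u <= l0 * n by rewrite leq_mul2l r0_le orbT.
    lia.
  move: x1; set x := xs _ _ _ _; move: hL l0_le; set N := #|S| => hL l0_le x1 h.
  have n_gt0 : 0 < n.
    apply: leq_trans (r0_le u); case: p pp sp {dp x1 h H nc} @x => [_ e|v p /= /andP[/r0_gt0]//].
    by rewrite -e in hL.
  have l0n : l0 * n.-1 <= N * n.-1 by rewrite leq_mul2r l0_le orbT.
  have lw : (l0 - w0) * N <= N * N by rewrite leq_mul2r; apply/orP; right; lia.
  have x2 : (- (N * n.-1)%:Z <= x)%R.
    have : l0 * n.-1 + l0 = l0 * n by rewrite addnC -mulnS prednK.
    by move: x1 l0n; clear; lia.
  have y1 : (- (N * (N * n.-1))%:Z <= N%:Z * x)%R.
    by have := ler_wpM2l (_ : 0 <= N%:Z)%R x2 => /(_ isT); lia.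
  have y2 : N * ((l0 - w0) * N) <= N * (N * N) by rewrite leq_mul2l lw orbT.
  have : N * (N * n.-1) + N * N = N * (N * n) by rewrite -mulnDr addnC -mulnS prednK.
  have : N <= N * N by rewrite leq_pmulr; lia.
  move: hL h y1 y2; rewrite mulnDr expnS expn1 -!mulnA; clear; lia.
exists l0, w0, (period l0 w0); split=> //; split.
- by move=> K; exact: period_le.
- move=> L L0; have := dlow L L0 => h; apply/andP; split; first lia.
  have [u [p [p1 p2 ->]]] := d_att L.
  (* Shortening below [#|S|] does not lower the excess, which is therefore at most [l0 * #|S|]. *)
  have [p' [_ _ q3 _ q5]] := reduce xs_closed (ltnSn 0) p1.
  have x1 := xs_le u p' w0_le.
  have h1 : (l0 - w0) * size p' <= l0 * #|S| by apply: leq_mul; lia.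
  have h2 : l0 * r0 u <= l0 * n by rewrite leq_mul2l r0_le orbT.
  move: q5 x1; rewrite {1}/xs p2 !mulnDr; lia.
move=> L h4 hL.
have step L1 L2 : 4 * #|S| ^ 2 <= L2 -> #|S| ^ 2 * (#|S| + n) < L1 -> 0 < L2 ->
    L2 = L1 %[mod period l0 w0] -> l0 * d L1 + w0 * L2 <= l0 * d L2 + w0 * L1.
  move=> g1 g2 L2_gt0; have [u [p [p1 p2 p3]]] := d_att L1.
  have vis := visit _ _ _ p1 p2 p3 g2.
  rewrite -{1}p2 => g3; have [p' [q1 q2 q3]] := transfer xs_closed p1 vis g1 g3.
  have := d_ub _ _ q1; rewrite q2 => /(_ L2_gt0) h.
  have : l0 * (r0 u + wt u p') <= l0 * d L2 by rewrite leq_mul2l h orbT.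
  move: q3; rewrite p3 /xs p2 q2 !mulnDr; lia.
have hL0 : 0 < L := leq_ltn_trans (leq0n _) hL.
have addL m : m <= L -> m <= L + period l0 w0 by move=> /leq_trans; apply; exact: leq_addr.
have := step L _ (addL _ h4) hL (addL _ hL0); have := step _ L h4 (addL _ hL) hL0.
rewrite !modnDr !mulnDr => /(_ erefl) a1 /(_ erefl) a2.
by move: a1 a2; clear; lia.
Qed.

End Walks.

(** * The tropical Hilbert function counts classes modulo 1 *)

From mathcomp Require Import classical_sets cardinality.
From mathcomp Require Import topology normedtype derive exp.
Import numFieldNormedType.Exports.
Local Open Scope classical_set_scope.
Local Open Scope ring_scope.

Section Rank.
Variable R : realType.
Implicit Types (z : nat -> R) (k : nat).

Lemma near0_horner (q : {poly R}) (e : R) : 0 < e ->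
  \forall t \near 0^'+, `|q.[t] - q.[0]| < e.
Proof.
move=> e0; have /cvg_at_right_filter/cvgrPdist_lt := @continuous_horner R q 0.
by move=> /(_ _ e0); apply: filterS => t; rewrite distrC.
Qed.

Lemma near0_root (q : {poly R}) : q != 0 -> \forall t \near 0^'+, q.[t] != 0.
Proof.
move=> q0; have [m [p]] := multiplicity_XsubC q 0.
rewrite q0 /= => p0 ->; near=> t; rewrite hornerM horner_exp hornerXsubC subr0.
have t0 : 0 < t by near: t; exact: nbhs_right_gt.
rewrite mulf_neq0 ?expf_neq0 ?(gt_eqF t0) //.

have : `|p.[t] - p.[0]| < `|p.[0]| by near: t; apply: near0_horner; rewrite normr_gt0.
by apply: contraTneq => ->; rewrite sub0r normrN ltxx.
Unshelve. all: by end_near. Qed.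

Lemma not_int_between (x : R) (m : int) : m%:~R < x -> x < (m + 1)%:~R ->
  x \isn't a Num.int.
Proof.
move=> h1 h2; apply/negP => /intrP[l xl]; move: h1 h2; rewrite xl !ltr_int; lia.
Qed.

Lemma floor_lt_nint (x : R) : x \isn't a Num.int -> (Num.floor x)%:~R < x.
Proof. by move=> h; rewrite lt_neqAle floor_le andbT -intrEfloor. Qed.

(** For integer [c], the perturbation [q.[t]] is small and nonzero; otherwise [c] has positive
    distance to the integers. *)
Lemma near0_nint (c : R) (q : {poly R}) : q != 0 -> q.[0] = 0 ->
  \forall t \near 0^'+, c + q.[t] \isn't a Num.int.
Proof.
move=> q0 q00; have [/intrP[l ->]|cn] := boolP (c \is a Num.int).
  near=> t; have t1 : `|q.[t] - q.[0]| < 1 by near: t; exact: near0_horner.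
  have t2 : q.[t] != 0 by near: t; exact: near0_root.
  rewrite q00 subr0 in t1; rewrite rpredDl ?intr_int //; apply/negP => /intrP[m qm].
  move: t1 t2; rewrite qm -intr_norm -[1]/(1%:~R) ltr_int intr_eq0; lia.
pose e := Num.min (c - (Num.floor c)%:~R) ((Num.floor c + 1)%:~R - c).
have e0 : 0 < e by rewrite lt_min !subr_gt0 floor_lt_nint // floorD1_gt.
near=> t; have : `|q.[t] - q.[0]| < e by near: t; exact: near0_horner.
rewrite q00 subr0 lt_min !ltr_norml => /andP[/andP[h1 h2] /andP[h3 h4]].
by apply: (@not_int_between _ (Num.floor c)); lra.
Unshelve. all: by end_near. Qed.

(* [fresh z i]: the class of [z i] in R/Z does not occur before position [i];
   [rk k z] thus counts the classes occurring among [z 0, ..., z (k - 1)]. *)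
Definition fresh z i : bool := [forall j : 'I_i, z i - z j \isn't a Num.int].

Definition rk k z : nat := \sum_(i < k) fresh z i.

Lemma fresh_rep z i : exists j, [/\ (j <= i)%N, fresh z j & z i - z j \is a Num.int].
Proof.
elim/ltn_ind: i => i IH; have [fi|] := boolP (fresh z i).
  by exists i; rewrite subrr rpred0.
rewrite negb_forall => /existsP[j]; rewrite negbK => ij.
have [l [h1 h2 h3]] := IH j (ltn_ord j).
exists l; split => //; first exact: leq_trans h1 (ltnW (ltn_ord j)).
by rewrite -(subrKA (z j)) rpredD.
Qed.

Lemma rk_card k z : rk k z = #|[set i : 'I_k | fresh z i]%SET|.
Proof. by rewrite /rk -sum1dep_card [RHS]big_mkcond; apply: eq_bigr => i _; case: fresh. Qed.

Lemma rkS k z : rk k.+1 z = (rk k z + fresh z k)%N.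
Proof. exact: big_ord_recr. Qed.

Lemma rk_eq k z z' : (forall i, (i < k)%N -> z i = z' i) -> rk k z = rk k z'.
Proof.
move=> h; apply: eq_bigr => i _; congr nat_of_bool; apply: eq_forallb => j.
by rewrite !h // (ltn_trans (ltn_ord j)).
Qed.

Lemma rk_le k z : (rk k z <= k)%N.
Proof. by rewrite rk_card (leq_trans (max_card _)) ?card_ord. Qed.

End Rank.

(** * Dimension of the polyhedra against the number of classes *)

Section Dimension.
Variables (R : realType) (n : nat) (a : 'I_n.+1 -> int).
Implicit Types (z : nat -> R) (k : nat).

Definition mintwice (y : nat -> R) : Prop := exists i1 i2 : 'I_n.+1,
  [/\ i1 != i2, forall i : 'I_n.+1, y i1 + (a i1)%:~R <= y i + (a i)%:~R
    & forall i : 'I_n.+1, y i2 + (a i2)%:~R <= y i + (a i)%:~R].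

Definition sat k z : Prop := forall j, (j + n < k)%N -> mintwice (fun i => z (j + i)%N).

Lemma satE k z : sat k z <-> D R a k (\row_i z i).
Proof.
split=> [h j|h j jk].
  have [|i1 [i2 [h1 h2 h3]]] := h j; first by have := ltn_ord j; lia.
  by exists i1, i2; split=> // i; rewrite !mxE; [exact: h2|exact: h3].
have jk' : (j < k - n)%N by lia.
have [i1 [i2 [h1 h2 h3]]] := h (Ordinal jk').
by exists i1, i2; split=> // i; [have := h2 i|have := h3 i]; rewrite !mxE.
Qed.

(** Raising all coordinates of one class by a small [e] preserves ties, since tied coordinates
    differ by integers, and preserves strict inequalities when [e] is below every gap. Each class
    contributes one direction. *)
Lemma rk_affine_dim k (c : {ffun 'I_(k - n) -> 'I_n.+1 * 'I_n.+1}) z :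
  D_polyhedron R a c (\row_i z i) -> (rk k z <= affine_dim (D_polyhedron R a c))%N.
Proof.
move=> Dz; rewrite rk_card; set F := [set i : 'I_k | _]%SET.
have [e e0 eP] : exists2 e : R, 0 < e & forall t : ('I_k * 'I_k) * ('I_n.+1 * 'I_n.+1),
    z t.1.1 + (a t.2.1)%:~R < z t.1.2 + (a t.2.2)%:~R ->
    z t.1.1 + (a t.2.1)%:~R + e <= z t.1.2 + (a t.2.2)%:~R.
  have h : \forall e \near (0:R)^'+, forall t : ('I_k * 'I_k) * ('I_n.+1 * 'I_n.+1),
      z t.1.1 + (a t.2.1)%:~R < z t.1.2 + (a t.2.2)%:~R ->
      z t.1.1 + (a t.2.1)%:~R + e <= z t.1.2 + (a t.2.2)%:~R.
    apply: filter_forall => t.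
    have [lt|_] := boolP (z t.1.1 + (a t.2.1)%:~R < z t.1.2 + (a t.2.2)%:~R); last first.
      exact: nearW.
    near=> e => _; rewrite -lerBrDl; apply/ltW; near: e.
    by apply: nbhs_right_lt; rewrite subr_gt0.
  near (0:R)^'+ => e; exists e; first by near: e; exact: nbhs_right_gt.
  by near: e.
pose A : 'M[R]_(#|F|, k) := \matrix_(i, j)
  if z j - z (@enum_val _ (mem F) i) \is a Num.int then e else 0.
have Fk : (#|F| < k.+1)%N by rewrite ltnS (leq_trans (max_card _)) ?card_ord.
apply: (bigop.bigmax_sup (Ordinal Fk)) => //=; apply/asboolP.
exists (\row_i z i), A; split=> //.
- move=> i j; have [h1 h2] := Dz j.
  suff H i1 : min_attained_at a (\row_i z i) j i1 ->
      min_attained_at a (\row_i z i + row i A) j i1 by split; exact: H.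
  move=> h i'; have := h i'; rewrite !mxE.
  set u := window j i1; set v := window j i'; rewrite le_eqVlt => /orP[/eqP uv|lt].
    have -> : (z u - z (enum_val i) \is a Num.int) = (z v - z (enum_val i) \is a Num.int).
      have -> : z u - z (enum_val i) = z v - z (enum_val i) + (a i' - a i1)%:~R.
        by rewrite rmorphB /=; lra.
      by rewrite rpredDr // intr_int.
    by rewrite addrAC uv addrAC.
  have := eP ((u, v), (i1, i')) lt => /=.
  by case: ifP => _; case: ifP => _; lra.
(* On the columns of the fresh positions [A] is [e] times the identity. *)
- apply/row_freeP; exists (\matrix_(j, i) if j == enum_val i then e^-1 else 0).
  apply/matrixP => i i'; rewrite !mxE (bigD1 (enum_val i')) //= big1 ?addr0; last first.
    by move=> j ji; rewrite !mxE (negbTE ji) mulr0.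
  rewrite !mxE eqxx; have [->|ii'] := eqVneq i i'.
    by rewrite subrr rpred0 mulfV // gt_eqF.
  case: ifP => // h; last by rewrite mul0r.
  have := enum_valP i; have := enum_valP i'; rewrite !inE => /forallP f1 /forallP f2.
  have : enum_val i != enum_val i' by apply: contraNneq ii' => /enum_val_inj ->.
  rewrite -val_eqE /= neq_ltn => /orP[lt|lt].
    by have := f1 (Ordinal lt); rewrite h.
  by have := f2 (Ordinal lt); rewrite -rpredN opprB h.
Unshelve. all: by end_near. Qed.

Definition extend_seq k (v : 'rV[R]_k) : nat -> R :=
  fun i => if insub i is Some o then v 0 o else 0.

Lemma extend_seqE k (v : 'rV[R]_k) (i : 'I_k) : extend_seq v i = v 0 i.
Proof. by rewrite /extend_seq valK. Qed.

(* A point in general position close to the vertex [x] of the simplex spanned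
   by [x] and [x + row i A]: two of its coordinates are congruent modulo 1 only
   if the corresponding columns of [A] agree. *)
Lemma affine_dim_rk k (c : {ffun 'I_(k - n) -> 'I_n.+1 * 'I_n.+1}) :
  (0 < affine_dim (D_polyhedron R a c))%N ->
  exists2 z : nat -> R, D_polyhedron R a c (\row_i z i)
    & (affine_dim (D_polyhedron R a c) <= rk k z)%N.
Proof.
pose P (d : nat) := `[< exists (x : 'rV[R]_k) (A : 'M[R]_(d, k)),
  [/\ D_polyhedron R a c x, forall i, D_polyhedron R a c (x + row i A)%R & row_free A] >].
have -> : affine_dim (D_polyhedron R a c) = (\max_(d < k.+1 | P d) d)%N by [].
move=> dim0.
have [d [x [A [Dx DxA fA]]] ->] : exists2 d : 'I_k.+1,
    exists (x : 'rV[R]_k) (A : 'M[R]_(d, k)),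
      [/\ D_polyhedron R a c x, forall i, D_polyhedron R a c (x + row i A)%R & row_free A]
    & (\max_(d < k.+1 | P d) d)%N = d.
  have [d0 Pd0|noP] := pickP (fun d : 'I_k.+1 => P d); last by rewrite big_pred0 in dim0.
  exists [arg max_(i > d0 | P i) i]; last exact: bigop.bigmax_eq_arg.
  by case: arg_maxnP => // i /asboolP.
(* [(q u v).[e]] is the difference between the displacements of coordinates [u] and [v]; distinct
   powers keep [q u v] nonzero when the columns differ. *)
pose q u v : {poly R} := \sum_(i < d) (A i u - A i v) *: 'X^(i.+1).
have q0 u v : (q u v).[0] = 0.
  by rewrite horner_sum big1 // => i _; rewrite hornerZ hornerXn expr0n mulr0.
have qn0 u v i : A i u != A i v -> q u v != 0.
  apply: contraNneq => /(congr1 (fun p : {poly R} => p`_i.+1)).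
  rewrite coef0 coef_sum (bigD1 i) //= big1 ?addr0.
    by rewrite coefZ coefXn eqxx mulr1 => /subr0_eq ->.
  by move=> j ji; rewrite coefZ coefXn eqSS eq_sym val_eqE (negbTE ji) mulr0.
have [e [e0 e1 eP]] : exists e : R, [/\ 0 < e, d%:R * e <= 1 & forall t : ('I_k * 'I_k) * 'I_d,
   A t.2 t.1.1 != A t.2 t.1.2 -> x 0 t.1.1 - x 0 t.1.2 + (q t.1.1 t.1.2).[e] \isn't a Num.int].
  near (0:R)^'+ => e; exists e; split.
  - by near: e; exact: nbhs_right_gt.
  - have : e < d.+1%:R^-1 by near: e; apply: nbhs_right_lt; rewrite invr_gt0.
    have e0 : 0 < e by near: e; exact: nbhs_right_gt.
    rewrite -(ltr_pM2l (ltr0Sn R d)) mulfV ?pnatr_eq0 // -natr1 mulrDl mul1r; lra.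
  - near: e; apply: filter_forall => t.
    have [h|h] := boolP (A t.2 t.1.1 != A t.2 t.1.2); last exact: nearW.
    have := near0_nint (x 0 t.1.1 - x 0 t.1.2) (qn0 _ _ _ h) (q0 _ _).
    by apply: filterS => e' he' _.
have e_le1 : (0 < d)%N -> e <= 1.
  move=> d0; apply: le_trans e1; rewrite ler_peMl ?(ltW e0) // ler1n //.
pose lam := \sum_(i < d) e ^+ i.+1.
have lam1 : lam <= 1.
  apply: le_trans e1; rewrite mulr_natl -[X in _ *+ X]card_ord -sumr_const.
  apply: ler_sum => i _; rewrite exprS; apply: ler_piMr; first exact: ltW.
  apply: exprn_ile1; first exact: ltW.
  by apply: e_le1; exact: leq_ltn_trans (ltn_ord i).
pose zv : 'rV[R]_k := x + \sum_(i < d) e ^+ i.+1 *: row i A.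
have zvE u : zv 0 u = x 0 u + \sum_(i < d) e ^+ i.+1 * A i u.
  by rewrite !mxE summxE; congr +%R; apply: eq_bigr => i _; rewrite !mxE.
have rowE : \row_i extend_seq zv i = zv.
  by apply/rowP => i; rewrite mxE extend_seqE.
exists (extend_seq zv).
  rewrite rowE => j.
  suff H i1 : min_attained_at a x j i1 -> (forall i, min_attained_at a (x + row i A) j i1) ->
      min_attained_at a zv j i1.
    by split; apply: H => [|i]; [have [] := Dx j| have [] := DxA i j|have [] := Dx j| have [] := DxA i j].
  move=> h hi i'; rewrite !zvE -subr_ge0; set v := window _ _; set u := window _ _.
  have -> : x 0 v + \sum_(i < d) e ^+ i.+1 * A i v + (a i')%:~R -
      (x 0 u + \sum_(i < d) e ^+ i.+1 * A i u + (a i1)%:~R) =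
    (1 - lam) * ((x 0 v + (a i')%:~R) - (x 0 u + (a i1)%:~R)) +
    \sum_(i < d) e ^+ i.+1 * (((x 0 v + A i v) + (a i')%:~R) - ((x 0 u + A i u) + (a i1)%:~R)).
    rewrite [X in _ = _ + X](eq_bigr (fun i : 'I_d => e ^+ i.+1 * A i v - e ^+ i.+1 * A i u +
      e ^+ i.+1 * ((x 0 v + (a i')%:~R) - (x 0 u + (a i1)%:~R)))); last by move=> i _; ring.
    by rewrite big_split /= sumrB -mulr_suml -/lam; ring.
  apply: addr_ge0; first by rewrite mulr_ge0 ?subr_ge0 //; exact: h.
  apply: sumr_ge0 => i _; rewrite mulr_ge0 ?exprn_ge0 ?(ltW e0) // subr_ge0.
  by have := hi i i'; rewrite !mxE.
have zE (u : 'I_k) : extend_seq zv u = x 0 u + \sum_(i < d) e ^+ i.+1 * A i u.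
  by rewrite extend_seqE.
rewrite rk_card; set F := [set i : 'I_k | _]%SET.
have /choice[f fP] : forall u : 'I_k, exists r : 'I_#|F|, forall i, A i u = A i (enum_val r).
  move=> u; have [j [ju fj uj]] := fresh_rep (extend_seq zv) u.
  pose o := Ordinal (leq_ltn_trans ju (ltn_ord u)).
  have oF : o \in F by rewrite inE.
  exists (enum_rank_in oF o) => i; rewrite enum_rankK_in //; apply/eqP/negPn/negP => neq.
  have /negP := eP ((u, o), i) neq; apply => /=; move: uj; rewrite -[j]/(nat_of_ord o) !zE.
  congr (_ \is a Num.int).
  rewrite horner_sum [X in _ = _ + X](eq_bigr (fun i : 'I_d => e ^+ i.+1 * A i u - e ^+ i.+1 * A i o)).
    by rewrite sumrB; ring.
  by move=> r _; rewrite hornerZ hornerXn; ring.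
have -> : (d : nat) = \rank A by apply/esym/eqP.
(* Every column of [A] repeats the column of a fresh position, so the rank is at most the number of
   these. *)
have -> : A = colsub (@enum_val _ (mem F)) A *m \matrix_(r, u) (r == f u)%:R.
  apply/matrixP => i u; rewrite !mxE (bigD1 (f u)) //= big1 ?addr0.
    by rewrite !mxE eqxx mulr1 fP.
  by move=> r ru; rewrite !mxE (negbTE ru) mulr0.
exact: leq_trans (mxrankM_maxl _ _) (rank_leq_col _).
Unshelve. all: by end_near. Qed.

Lemma rk_hilbert k z : sat k z -> (rk k z <= hilbert R a k)%N.
Proof.
move=> /satE; rewrite D_bigcup => -[c /= cc Dc].
exact: leq_trans (rk_affine_dim Dc) (leq_bigmax_cond _ cc).
Qed.

Lemma hilbert_rk k : (exists z, sat k z) -> exists2 z, sat k z & hilbert R a k = rk k z.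
Proof.
move=> [z0 sz0]; suff [z sz hz] : exists2 z, sat k z & (hilbert R a k <= rk k z)%N.
  by exists z => //; apply/eqP; rewrite eqn_leq hz rk_hilbert.
have [->|h0] := posnP (hilbert R a k); first by exists z0.
have [c0 cc0|noc] := pickP (@choice_of_pairs n k); last first.
  by move: h0; rewrite /hilbert big_pred0.
move: h0; rewrite /hilbert (bigop.bigmax_eq_arg _ cc0).
case: arg_maxnP => // c cc _ h0.
have [z Dz hz] := affine_dim_rk h0.
by exists z => //; apply/satE; rewrite D_bigcup; exists c.
Qed.

End Dimension.

(** * Cells of windows *)

Section Cells.
Variables (R : realType) (m : nat) (a : 'I_m.+2 -> int).
Implicit Types (y : nat -> R) (i j r l s : 'I_m.+1).

Lemma amplitude_ge (i j : 'I_m.+2) : a i - a j <= amplitude a.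
Proof. by apply: lerB; [exact: le_bigmax|exact: bigmin_le]. Qed.

Lemma le_intE (x : R) (c : int) :
  (x <= c%:~R) = (Num.floor x < c) || (Num.floor x == c) && (x \is a Num.int).
Proof.
rewrite intrEfloor floor_lt_int; case: (ltgtP x c%:~R) => [//|lt|->] /=.
  by apply/esym/negP => /andP[/eqP fc /eqP e]; move: lt; rewrite -fc e ltxx.
by rewrite intrKfloor !eqxx.
Qed.

Lemma floor_eq_lt (x x' : R) :
  (forall c : int, (x < c%:~R) = (x' < c%:~R)) -> Num.floor x = Num.floor x'.
Proof.
move=> h; apply/eqP; rewrite eq_le -ltzD1 floor_lt_int h -floor_lt_int ltzD1 lexx /=.
by rewrite -ltzD1 floor_lt_int -h -floor_lt_int ltzD1.
Qed.

Definition same_diff (x x' : R) : Prop := Num.floor x = Num.floor x' /\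
  (x \is a Num.int) = (x' \is a Num.int).

Lemma same_diff_lt x x' : same_diff x x' -> forall c : int, (x < c%:~R) = (x' < c%:~R).
Proof. by move=> [h1 h2] c; rewrite -!floor_lt_int h1. Qed.

Lemma same_diff_le x x' : same_diff x x' -> forall c : int, (x <= c%:~R) = (x' <= c%:~R).
Proof. by move=> [h1 h2] c; rewrite !le_intE h1 h2. Qed.

Lemma same_diffP x x' : (forall c : int, (x < c%:~R) = (x' < c%:~R)) ->
  (forall c : int, (x <= c%:~R) = (x' <= c%:~R)) -> same_diff x x'.
Proof.
move=> h1 h2; have fE := floor_eq_lt h1; split=> //.
have := h2 (Num.floor x); rewrite !le_intE fE eqxx ltxx /=; by [].
Qed.

Lemma same_diff_opp x x' : same_diff x x' -> same_diff (- x) (- x').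
Proof.
move=> h; apply: same_diffP => c; rewrite -[c]opprK rmorphN /= ?ltrN2 ?lerN2.
  by rewrite !ltNge (same_diff_le h).
by rewrite !leNgt (same_diff_lt h).
Qed.

Lemma same_diff_addr x x' (c : int) : same_diff x x' -> same_diff (x + c%:~R) (x' + c%:~R).
Proof.
by move=> [h1 h2]; split; rewrite ?floorDrz ?intr_int // ?intrKfloor ?h1 // !rpredDr ?intr_int.
Qed.

Lemma smin_exists y : exists s, (forall j, y s <= y j) /\ (forall j, (j < s)%N -> y s < y j).
Proof.
pose P s := [forall j : 'I_m.+1, y s <= y j].
have Ps0 : P [arg min_(i < ord0) y i]%O.
  by case: arg_minP => // i _ h; apply/forallP => j; exact: h.
case: (arg_minnP (fun i : 'I_m.+1 => i : nat) Ps0) => s /forallP h1 h2.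
exists s; split=> // j js; rewrite lt_neqAle h1 andbT; apply/eqP => e.
have : P j by apply/forallP => l; rewrite -e.
by move=> /h2; rewrite leqNgt js.
Qed.

Definition smin y : 'I_m.+1 := projT1 (cid (smin_exists y)).

Lemma smin_le y j : y (smin y) <= y j.
Proof. by rewrite /smin; case: cid => s []. Qed.

Lemma smin_lt y j : (j < smin y)%N -> y (smin y) < y j.
Proof. by rewrite /smin; case: cid => s /= [_ h]; exact: h. Qed.

Lemma smin_uniq y s : (forall j, y s <= y j) -> (forall j, (j < s)%N -> y s < y j) ->
  smin y = s.
Proof.
move=> h1 h2; apply/val_inj; case: (ltngtP (smin y) s) => // /=.
  by move=> /h2; rewrite ltNge smin_le.
by move=> /smin_lt; rewrite ltNge h1.
Qed.

Definition Bset y : {set 'I_m.+1} :=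
  [set j : 'I_m.+1 | y j - y (smin y) <= (j.+1%:Z * amplitude a)%:~R]%SET.

(** The vertex read off from a window: the strict inequalities for [e = 1] say that [m] is the floor
    of a non-integral difference. *)
Definition cls y : {set 'I_m.+1} * 'I_m.+1 * 'M[int]_m.+1 * 'M[bool]_m.+1 :=
  (Bset y, smin y,
   \matrix_(r, l) (if [&& r \in Bset y, l \in Bset y & (r < l)%N] then Num.floor (y r - y l) else 0),
   \matrix_(r, l) ([&& r \in Bset y, l \in Bset y & (r < l)%N] && (y r - y l \isn't a Num.int))).

Lemma smin_B y : smin y \in Bset y.
Proof.
rewrite inE subrr ler0z mulr_ge0 //; exact: amplitude_ge0.
Qed.

Lemma notin_B y j : j \notin Bset y -> (j.+1%:Z * amplitude a)%:~R < y j - y (smin y).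
Proof. by rewrite inE -ltNge. Qed.

Lemma cls_inj y y' : cls y = cls y' -> [/\ Bset y = Bset y', smin y = smin y' &
  forall r l, r \in Bset y -> l \in Bset y -> same_diff (y r - y l) (y' r - y' l)].
Proof.
move=> [eB es em ee]; split=> //.
have H r l : r \in Bset y -> l \in Bset y -> (r < l)%N -> same_diff (y r - y l) (y' r - y' l).
  move=> rB lB rl; move/matrixP/(_ r l): em; move/matrixP/(_ r l): ee; rewrite !mxE.
  by rewrite -eB rB lB rl /= => /negb_inj.
move=> r l rB lB; case: (ltngtP r l) => [|lr|/val_inj ->].
- exact: H.
- by rewrite -opprB -[y' r - _]opprB; apply: same_diff_opp; exact: H.
- by rewrite !subrr.
Qed.

(** An entry outside [G] lies too far above an entry of [G] to be minimal or to enter [Bset], so the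
    differences within [G] determine everything. This spares computing [Bset] after a shift. *)
Lemma cls_eq (G : {set 'I_m.+1}) y y' :
  (forall r l, r \in G -> l \in G -> same_diff (y r - y l) (y' r - y' l)) ->
  (forall j, j \notin G -> exists2 g, g \in G & (j.+1%:Z * amplitude a)%:~R < y j - y g) ->
  (forall j, j \notin G -> exists2 g, g \in G & (j.+1%:Z * amplitude a)%:~R < y' j - y' g) ->
  cls y = cls y'.
Proof.
move=> hG hy hy'.
have M0 j : 0 <= (j.+1%:Z * amplitude a)%:~R :> R.
  by rewrite ler0z mulr_ge0 // amplitude_ge0.
have sG : smin y \in G.
  apply/negPn/negP => /hy[g _]; have := M0 (smin y); have := smin_le y g; lra.
have leG r l : r \in G -> l \in G -> (y r <= y l) = (y' r <= y' l).
  by move=> rG lG; have := same_diff_le (hG r l rG lG) 0; rewrite !subr_le0.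
have ltG r l : r \in G -> l \in G -> (y r < y l) = (y' r < y' l).
  by move=> rG lG; rewrite !ltNge leG.
have es : smin y' = smin y.
  apply: smin_uniq => j.
    have [jG|/hy'[g gG]] := boolP (j \in G); first by rewrite -leG // smin_le.
    have := M0 j; have : y' (smin y) <= y' g by rewrite -leG // smin_le.
    lra.
  have [jG|/hy'[g gG]] := boolP (j \in G); first by rewrite -ltG //; exact: smin_lt.
  have := M0 j; have : y' (smin y) <= y' g by rewrite -leG // smin_le.
  lra.
have BG j : j \in Bset y -> j \in G.
  rewrite inE => jB; apply/negPn/negP => /hy[g gG]; have := smin_le y g; lra.
have eB : Bset y = Bset y'.
  apply/setP => j; rewrite !inE es; have [jG|jG] := boolP (j \in G).
    by rewrite (same_diff_le (hG j _ jG sG)).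
  have [g gG g1] := hy _ jG; have [g' gG' g2] := hy' _ jG.
  have := smin_le y g; have := smin_le y' g'; rewrite es => h1 h2.
  by transitivity false; [|symmetry]; apply/negP => h; move: h1 h2 g1 g2 h; clear; lra.
rewrite /cls -eB es; congr (_, _, _, _); apply/matrixP => r l; rewrite !mxE.
  by case: ifP => // /and3P[/BG rG /BG lG _]; have [] := hG r l rG lG.
case: (boolP [&& _, _ & _]) => //= /and3P[/BG rG /BG lG _].
by have [_ ->] := hG r l rG lG.
Qed.

Lemma cls_ext y y' : (forall j, y j = y' j) -> cls y = cls y'.
Proof.
move=> h; apply: (@cls_eq [set: 'I_m.+1]) => [r l _ _|j|j]; rewrite ?inE //.
by rewrite !h.
Qed.

Lemma cls_vertex y : vertices R a (cls y).
Proof.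
have M0 := amplitude_ge0 a; set M := amplitude a in M0 *.
have flo r l : r \in Bset y -> l \in Bset y -> y r - y l <= (r.+1%:Z * M)%:~R.
  by rewrite !inE => h _; have := smin_le y l; lra.
have floN r l : r \in Bset y -> l \in Bset y -> - (m.+1%:Z * M) <= Num.floor (y r - y l).
  move=> rB lB; rewrite floor_ge_int rmorphN /= lerNl opprB (le_trans (flo l r lB rB)) // ler_int.
  by rewrite ler_wpM2r // lez_nat.
have flo' r l : r \in Bset y -> l \in Bset y -> Num.floor (y r - y l) <= r.+1%:Z * M.
  move=> rB lB; rewrite -ltzD1 floor_lt_int (le_lt_trans (flo r l rB lB)) // ltr_int; lia.
have py : vertex_polyhedron R a (Bset y) (smin y) (cls y).1.2 (cls y).2 (\row_i y i).
  split=> [j|r l rB lB rl|r l rB lB rl|j jB]; rewrite !mxE.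
  - exact: smin_le.
  - rewrite rB lB rl /= => /negbFE; rewrite intrEfloor => /eqP ->; lra.
  - rewrite rB lB rl /= => h; have := floor_lt_nint h; have := floorD1_gt (y r - y l).
    rewrite rmorphD /= => h1 h2; apply/andP; split; lra.
  - exact: notin_B.
split=> /=.
- exact: smin_B.
- by move=> r l /negbTE h; rewrite !mxE h.
- split.
  + by move=> q qB sq; rewrite mxE smin_B qB sq /=; exact: floN (smin_B y) qB.
  + move=> p pB ps; rewrite mxE smin_B pB ps /=; apply: le_trans (flo' _ _ pB (smin_B y)) _.
    by apply: ler_wpM2r => //; have := ltn_ord p; lia.
  + move=> r l rB lB rl; rewrite mxE rB lB rl /=.
    have h1 := floN r l rB lB; have h2 := flo' r l rB lB.
    have : r.+1%:Z * M <= m.+1%:Z * M by apply: ler_wpM2r => //; have := ltn_ord r; lia.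
    have : 0 <= m.+1%:Z * M by rewrite mulr_ge0.
    by rewrite -mulrA; lia.
- by exists (\row_i y i).
- move=> y' [_ h0 h1 _] p pB ps; have lt := smin_lt ps.
  have := h0 p (smin y) pB (smin_B y) ps; have := h1 p (smin y) pB (smin_B y) ps.
  rewrite !mxE pB smin_B ps /=.
  have f0 : 0 <= Num.floor (y p - y (smin y)) by rewrite floor_ge_int subr_ge0 ltW.
  have f0' : 0 <= (Num.floor (y p - y (smin y)))%:~R :> R by rewrite ler0z.
  case: (boolP (_ \is a Num.int)) => /= [yi _ /(_ erefl)|yi /(_ erefl) /andP[_ h] _]; last by lra.
  move: yi; rewrite intrEfloor => /eqP -> ->; lra.
Qed.

End Cells.

(** * Continuing a sequence by one entry *)

Section Extension.
Variables (R : realType) (m : nat) (a : 'I_m.+2 -> int).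
Implicit Types (y : nat -> R) (i j r l s : 'I_m.+1).

Definition behead_seq y : nat -> R := fun i : nat => y i.+1.

(** Comparison with [Bset] suffices: an entry not tied to it modulo 1 can be moved within its cell
    off any finite set of classes, as [extension] shows. *)
Definition new_class y : bool :=
  [forall j : 'I_m.+1, (j \in Bset a y) ==> (y m.+1 - y j \isn't a Num.int)].

Lemma notin_B_gt y j : j \notin Bset a y ->
  (j.+1%:Z * amplitude a)%:~R + y (smin m y) < y j /\ (amplitude a)%:~R + y (smin m y) < y j.
Proof.
move=> /notin_B h; split; first by lra.
have : amplitude a <= j.+1%:Z * amplitude a by have := amplitude_ge0 a; nia.
rewrite -(ler_int R); lra.
Qed.

Lemma ord_maxP (i : 'I_m.+2) : i = m.+1 :> nat \/ exists j : 'I_m.+1, i = j :> nat.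
Proof.
case: (ltnP i m.+1) => h; first by right; exists (Ordinal h).
by left; have := ltn_ord i; lia.
Qed.

Lemma amplitude_geR (i j : 'I_m.+2) : (a i)%:~R - (a j)%:~R <= (amplitude a)%:~R :> R.
Proof. by rewrite -rmorphB ler_int amplitude_ge. Qed.

(* By the definition of [Bset], an entry outside [Bset y] exceeds the minimum
   by so much that it attains the minimum neither in this window nor in any of
   the following ones. *)
Lemma next_cls y y' : cls a y = cls a y' ->
  (forall r, r \in Bset a y -> same_diff (y m.+1 - y r) (y' m.+1 - y' r)) ->
  mintwice a y' -> mintwice a y /\ cls a (behead_seq y) = cls a (behead_seq y').
Proof.
move=> /cls_inj[eB es hB] hn [i1 [i2 [i12 h1 h2]]].
have {es} sE (x : nat -> R) : x (smin m y') = x (smin m y) by rewrite es.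
have {eB} BE j : (j \in Bset a y') = (j \in Bset a y) by rewrite eB.
pose G (i : 'I_m.+2) := i = m.+1 :> nat \/ exists2 j, j \in Bset a y & i = j :> nat.
have nG (i : 'I_m.+2) : ~ G i -> exists2 j, j \notin Bset a y & i = j :> nat.
  move=> Gi; case: (ord_maxP i) => [e|[j e]]; first by case: Gi; left.
  by exists j => //; apply/negP => jB; apply: Gi; right; exists j.
have sd (i i' : 'I_m.+2) : G i -> G i' -> same_diff (y i - y i') (y' i - y' i').
  move=> [->|[r rB ->]] [->|[l lB ->]].
  - by rewrite !subrr.
  - exact: hn.
  - by rewrite -opprB -[y' r - _]opprB; apply: same_diff_opp; exact: hn.
  - exact: hB.
have sB : smin m y \in Bset a y := smin_B a y.
pose s0 : 'I_m.+2 := widen_ord (leqnSn _) (smin m y).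
have s0E (x : nat -> R) : x s0 = x (smin m y) by [].
have minG (i : 'I_m.+2) : (forall i' : 'I_m.+2, y' i + (a i)%:~R <= y' i' + (a i')%:~R) -> G i.
  move=> hi; apply: contrapT => /nG[j jB e]; rewrite -BE in jB.
  have [_ lt] := notin_B_gt jB; rewrite sE in lt; have := hi s0; rewrite s0E e.
  have := amplitude_geR s0 i; lra.
have Gs0 : G s0 by right; exists (smin m y).
have min1 (i : 'I_m.+2) : (forall i' : 'I_m.+2, y' i + (a i)%:~R <= y' i' + (a i')%:~R) ->
    forall i' : 'I_m.+2, y i + (a i)%:~R <= y i' + (a i')%:~R.
  move=> hi; have Gi := minG i hi.
  have step (i' : 'I_m.+2) : G i' -> y i + (a i)%:~R <= y i' + (a i')%:~R.
    move=> Gi'; have := same_diff_le (sd _ _ Gi Gi') (a i' - a i).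
    rewrite rmorphB /= => e.
    have : y' i - y' i' <= (a i')%:~R - (a i)%:~R by have := hi i'; lra.
    rewrite -e; lra.
  move=> i'; have [/step//|/nG[j jB ej]] := pselect (G i').
  have [_ lt] := notin_B_gt jB; have := step s0 Gs0; rewrite s0E ej.
  have := amplitude_geR s0 i'; lra.
have m1 := min1 _ h1; have m2 := min1 _ h2.
split; first by exists i1, i2.
(* Of two places attaining the minimum, one is not the first and survives the shift. *)
have [i0 [i0_gt0 mi0 mi0']] : exists i0 : 'I_m.+2, [/\ (0 < i0)%N,
   forall i' : 'I_m.+2, y i0 + (a i0)%:~R <= y i' + (a i')%:~R &
   forall i' : 'I_m.+2, y' i0 + (a i0)%:~R <= y' i' + (a i')%:~R].
  have [z1|p1] := posnP i1; last by exists i1.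
  exists i2; split=> //; rewrite lt0n; apply: contraNneq i12 => z2.
  by rewrite -val_eqE /= z1 z2.
pose g0 : 'I_m.+1 := inord i0.-1.
have g0E : g0.+1 = i0 by rewrite inordK ?prednK //; have := ltn_ord i0; lia.
pose G' := [set i : 'I_m.+1 | `[< G (lift ord0 i) >]]%SET.
have liftE i : lift ord0 i = i.+1 :> nat by [].
have g0G : g0 \in G'.
  rewrite inE; apply/asboolP; suff -> : lift ord0 g0 = i0 by exact: minG.
  by apply/val_inj; rewrite /= -g0E.
(* The entry [i0] exceeds the old minimum by at most the amplitude [M]; the shift lowers the index
   of a far entry by one, so the gap required of it drops by exactly [M]. *)
have far (x : nat -> R) j : (forall j, (j \in Bset a x) = (j \in Bset a y)) ->
    x (smin m x) = x (smin m y) ->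
    (forall i' : 'I_m.+2, x i0 + (a i0)%:~R <= x i' + (a i')%:~R) ->
    j \notin G' -> exists2 g, g \in G' & (j.+1%:Z * amplitude a)%:~R < behead_seq x j - behead_seq x g.
  move=> xB xs hx; rewrite inE => /asboolP/nG[r]; rewrite liftE -xB => rB er.
  exists g0 => //; rewrite /behead_seq er g0E.
  have [lt _] := notin_B_gt rB; have := hx s0; rewrite s0E -xs.
  have := amplitude_geR s0 i0; move: lt.
  rewrite -er -[j.+2]addn1 PoszD mulrDl mul1r rmorphD /=; lra.
apply: (@cls_eq _ _ _ G').
- move=> r l; rewrite !inE => /asboolP/asboolP Gr /asboolP/asboolP Gl.
  by have := sd _ _ Gr Gl; rewrite !liftE.
- by move=> j; exact: far.
- by move=> j; exact: far.
Qed.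

Lemma avoid_classes (x : R) (e : R) (F : seq R) : 0 < e -> exists t : R,
  [/\ x < t, t < x + e & forall f, f \in F -> t - f \isn't a Num.int].
Proof.
move=> e0; near (0 : R)^'+ => d; exists (x + d); split.
- by rewrite ltrDl; near: d; exact: nbhs_right_gt.
- by rewrite ltrD2l; near: d; exact: nbhs_right_lt.
- near: d; elim: F => [|f F IH]; first by near=> d.
  near=> d => g; rewrite inE => /orP[/eqP ->|].
    have := @near0_nint R (x - f) 'X; rewrite hornerX => /(_ _ erefl) h.
    rewrite addrAC -[d in x - f + d]hornerX; near: d; apply: near0_nint.
      by rewrite polyX_eq0.
    by rewrite hornerX.
  by move: g; near: d.
Unshelve. all: by end_near. Qed.

(** If the last entry of [y'] is congruent to one in [Bset], then [t] is copied from it. Otherwise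
    [t] ranges over an intersection of open unit intervals, where finitely many classes can be
    avoided. *)
Lemma extension y y' (F : seq R) : cls a y = cls a y' -> exists t : R,
  (forall r, r \in Bset a y -> same_diff (t - y r) (y' m.+1 - y' r)) /\
  (new_class y' -> forall f, f \in F -> t - f \isn't a Num.int).
Proof.
move=> /cls_inj[eB _ hB]; have {eB} BE j : (j \in Bset a y') = (j \in Bset a y) by rewrite eB.
have [nw|] := boolP (new_class y'); last first.
  rewrite negb_forall => /existsP[j]; rewrite negb_imply negbK BE => /andP[jB /intrP[c yj]].
  exists (y j + c%:~R); split=> // r rB.
  have -> : y' m.+1 - y' r = (y' j - y' r) + c%:~R by lra.
  by rewrite addrAC; apply: same_diff_addr; exact: hB.
pose f r : int := Num.floor (y' m.+1 - y' r).
have [r0 r0B r0max] : exists2 r0, r0 \in Bset a y & forall r, r \in Bset a y ->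
    y r + (f r)%:~R <= y r0 + (f r0)%:~R.
  case: (@Order.TotalTheory.arg_maxP _ _ _ (smin m y) (mem (Bset a y)) (fun r => y r + (f r)%:~R) (smin_B a y)).
  by move=> r0 h1 h2; exists r0.
(* The highest lower end [r0] is below each upper end: for [y'] the last entry lies between them,
   and this comparison of a difference with an integer carries over to [y]. *)
have ub r : r \in Bset a y -> y r0 + (f r0)%:~R < y r + (f r)%:~R + 1.
  move=> rB; have := same_diff_lt (hB r0 r r0B rB) (f r + 1 - f r0).
  have h1 : (f r0)%:~R <= y' m.+1 - y' r0 := floor_le _.
  have h2 : y' m.+1 - y' r < (f r + 1)%:~R := floorD1_gt _.
  rewrite !rmorphD rmorphN /= in h2 *.
  have -> : y' r0 - y' r < (f r)%:~R + 1 - (f r0)%:~R by lra.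
  lra.
pose top := [arg min_(r < r0 in Bset a y) (y r + (f r)%:~R + 1)]%O.
have [tB topmin] : top \in Bset a y /\ forall r, r \in Bset a y ->
    y top + (f top)%:~R + 1 <= y r + (f r)%:~R + 1.
  by rewrite /top; case: Order.TotalTheory.arg_minP => // r1 h1 h2; split.
have e0 : 0 < y top + (f top)%:~R + 1 - (y r0 + (f r0)%:~R) by rewrite subr_gt0 ub.
have [t [t1 t2 tF]] := avoid_classes (y r0 + (f r0)%:~R) F e0.
exists t; split=> // r rB.
have u1 := r0max _ rB; have u2 := topmin _ rB.
have v1 : (f r)%:~R < t - y r by lra.
have v2 : t - y r < (f r + 1)%:~R by rewrite rmorphD /=; lra.
split; first by apply: floor_def; rewrite (ltW v1).
rewrite (negbTE (not_int_between v1 v2)); apply/esym/negbTE.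
by move/forallP/(_ r): nw; rewrite BE rB.
Qed.

Lemma mintwice_exists y : exists t, mintwice a (fun i : nat => if i == m.+1 then t else y i).
Proof.
pose F (i : 'I_m.+1) : R := y i + (a (widen_ord (leqnSn _) i))%:~R.
pose r := [arg min_(i < ord0) F i]%O.
have rmin i : F r <= F i by rewrite /r; case: Order.TotalTheory.arg_minP => // j _; exact.
exists (F r - (a ord_max)%:~R), ord_max, (widen_ord (leqnSn _) r).
have rE (i : 'I_m.+1) : (i == m.+1 :> nat) = false by apply/negbTE; have := ltn_ord i; lia.
have H (i : 'I_m.+2) : F r <= (if i == m.+1 :> nat then F r - (a ord_max)%:~R else y i) + (a i)%:~R.
  case: (ord_maxP i) => [e|[j e]].
    by rewrite e eqxx (_ : i = ord_max) ?subrK //; exact/val_inj.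
  by rewrite e rE; have := rmin j; rewrite /F (_ : widen_ord _ j = i) //; exact/val_inj.
split=> [|i|i].
- by rewrite -val_eqE /= eq_sym rE.
- by rewrite /= eqxx subrK; exact: H.
- by rewrite [val (widen_ord _ _)]/= rE; exact: H.
Qed.

End Extension.

Lemma mintwice_ext (R : realType) (n : nat) (a : 'I_n.+1 -> int) (y y' : nat -> R) :
  (forall i : 'I_n.+1, y i = y' i) -> mintwice a y -> mintwice a y'.
Proof.
by move=> e [i1 [i2 [h h1 h2]]]; exists i1, i2; split=> // i; rewrite -!e.
Qed.

(** * Sequences as walks in the graph of cells *)

Section Graph.
Variables (R : realType) (m : nat) (a : 'I_m.+2 -> int).
Implicit Types (y z : nat -> R) (L : nat).

Local Notation S := (fset_set (vertices R a)).

Lemma state_subproof y : cls a y \in S.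
Proof. by rewrite in_fset_set ?mem_set //; [exact: cls_vertex|exact: vertices_finite]. Qed.

Definition state y : S := [` state_subproof y]%fset.

Lemma state_eq y y' : cls a y = cls a y' -> state y = state y'.
Proof. by move=> h; apply/val_inj. Qed.

Lemma state_cls y y' : state y = state y' -> cls a y = cls a y'.
Proof. by move=> /(congr1 val). Qed.

Definition edge (u v : S) : bool :=
  `[< exists y, [/\ mintwice a y, state y = u & state (behead_seq y) = v] >].

Definition weight (u v : S) : bool :=
  `[< exists y, [/\ mintwice a y, state y = u, state (behead_seq y) = v & new_class a y] >].

(** A maximum over windows, as a cell says nothing about the classes of entries outside [Bset]. *)
Definition start_rank (u : S) : nat :=
  (\max_(i < m.+2 | `[< exists2 y, state y = u & rk m.+1 y = i >]) i)%N.

Lemma start_rank_le u : (start_rank u <= m.+1)%N.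
Proof. by apply/bigop.bigmax_leqP => i _; rewrite -ltnS. Qed.

Lemma start_rank_ge y : (rk m.+1 y <= start_rank (state y))%N.
Proof.
have h : (rk m.+1 y < m.+2)%N by rewrite ltnS rk_le.
by apply: (bigop.bigmax_sup (Ordinal h)) => //; apply/asboolP; exists y.
Qed.

Lemma start_rankP y : exists2 y', state y' = state y & rk m.+1 y' = start_rank (state y).
Proof.
have h : (rk m.+1 y < m.+2)%N by rewrite ltnS rk_le.
pose P (i : 'I_m.+2) := `[< exists2 y', state y' = state y & rk m.+1 y' = i >].
have Ph : P (Ordinal h) by apply/asboolP; exists y.
rewrite /start_rank (bigop.bigmax_eq_arg _ Ph).
by case: arg_maxnP => // i /asboolP.
Qed.

Lemma start_rank_gt0 y : (0 < start_rank (state y))%N.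
Proof.
apply: leq_trans (start_rank_ge y); rewrite /rk big_ord_recl /=.
suff -> : fresh y 0 by [].
by apply/forallP => -[].
Qed.

(** Only an inequality: an entry new in its window may repeat a class met earlier. *)
Lemma walk_of_sat L z : sat a (L + m.+1) z -> exists p,
  [/\ path edge (state z) p, size p = L, last (state z) p = state (fun i => z (L + i)%N)
    & (rk (L + m.+1) z <= rk m.+1 z + wt weight (state z) p)%N].
Proof.
elim: L => [|L IH] sz; first by exists [::]; rewrite addn0; split.
have [|p [p1 p2 p3 p4]] := IH; first by move=> j hj; apply: sz; lia.
pose y i := z (L + i)%N.
have my : mintwice a y by apply: sz; lia.
have sy : state (behead_seq y) = state (fun i => z (L.+1 + i)%N).
  by apply/state_eq/cls_ext => j; rewrite /behead_seq /y addnS.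
exists (rcons p (state (behead_seq y))); rewrite rcons_path p1 p3 size_rcons p2 last_rcons; split=> //.
  by apply/asboolP; exists y.
rewrite addSn rkS -cats1 wt_cat /= p3 addn0 addnA leq_add //.
case: (boolP (fresh z _)) => //= /forallP fz; rewrite lt0b; apply/asboolP.
exists y; split=> //; apply/forallP => j; apply/implyP => _.
have jL : (L + j < L + m.+1)%N by rewrite ltn_add2l.
exact: fz (Ordinal jL).
Qed.

(** Built entry by entry with [extension]; taking all earlier entries as the set to avoid makes each
    step of weight 1 create a class new to the whole sequence. *)
Lemma sat_of_walk y p : path edge (state y) p -> exists z,
  [/\ sat a (size p + m.+1) z, state (fun i => z (size p + i)%N) = last (state y) p
    & (start_rank (state y) + wt weight (state y) p <= rk (size p + m.+1) z)%N].
Proof.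
elim/last_ind: p => [_|p v IH].
  have [y' e1 e2] := start_rankP y; exists y'; split=> //=.
    by move=> j; lia.
  by rewrite addn0 -e2.
rewrite rcons_path size_rcons last_rcons => /andP[/IH[z [sz lz rz]] e].
set L := size p in sz lz rz *.
have [y' [my' sy' ty' wy']] : exists y', [/\ mintwice a y', state y' = last (state y) p,
    state (behead_seq y') = v & weight (last (state y) p) v -> new_class a y'].
  have [/asboolP[y' [h1 h2 h3 h4]]|_] := boolP (weight (last (state y) p) v).
    by exists y'; split.
  by move/asboolP: e => [y' [h1 h2 h3]]; exists y'; split.
have cz : cls a (fun i => z (L + i)%N) = cls a y' by apply: state_cls; rewrite lz sy'.
have [t [ht tF]] := extension [seq z i | i <- iota 0 (L + m.+1)] cz.
pose z2 i := if i == (L + m.+1)%N then t else z i.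
have z2E i : (i < L + m.+1)%N -> z2 i = z i by move=> h; rewrite /z2 ltn_eqF.
have cz2 : cls a (fun i => z2 (L + i)%N) = cls a (fun i => z (L + i)%N).
  by apply: cls_ext => j; rewrite z2E // ltn_add2l.
have [|m2 c2] := next_cls (etrans cz2 cz) _ my'.
  move=> r rB; rewrite /z2 eqxx ltn_eqF ?ltn_add2l //.
  by apply: ht; move: rB; have [-> _ _] := cls_inj cz2.
exists z2; split.
- move=> j hj; have [jL|jL] := ltnP j L.
    apply: mintwice_ext (sz j _); last by lia.
    by move=> i; rewrite z2E //; have := ltn_ord i; lia.
  by have -> : j = L by lia.
- rewrite -ty'; apply: state_eq; rewrite -c2; apply: cls_ext => j.
  by rewrite /behead_seq addnS.
rewrite addSn rkS -cats1 wt_cat /= addn0 addnA leq_add //.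
  by rewrite (@rk_eq _ _ z2 z) // => i; exact: z2E.
case: (boolP (weight _ _)) => //= /wy' /tF h; rewrite lt0b.
apply/forallP => j; rewrite /z2 eqxx ltn_eqF //; apply: h.
by apply/mapP; exists (j : nat) => //; rewrite mem_iota ltn_ord.
Qed.

Lemma sat_exists L : exists z, sat a (L + m.+1) z.
Proof.
elim: L => [|L [z sz]]; first by exists (fun=> 0) => j; lia.
have [t mt] := mintwice_exists a (fun i => z (L + i)%N).
exists (fun i => if i == (L + m.+1)%N then t else z i) => j hj.
have [jL|jL] := ltnP j L.
  apply: mintwice_ext (sz j _); last by lia.
  by move=> i; rewrite ltn_eqF //; have := ltn_ord i; lia.
have -> : j = L by lia.
by apply: mintwice_ext mt => i; rewrite eqn_add2l.
Qed.

Theorem hilbert_periodicity (N := nb_vertices R a) :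
  exists l0 w0 per, [/\ 0 < l0, w0 <= l0, 0 < per &
   [/\ forall K, N <= K ^ 2 -> 0 < K -> per <= N.+1 ^ (2 * K),
       forall L, 0 < L -> w0 * L <= l0 * hilbert R a (L + m.+1) <= w0 * L + l0 * (m.+1 + N) &
       forall L, 4 * N ^ 2 <= L -> N ^ 2 * (N + m.+1) < L ->
         l0 * hilbert R a (L + per + m.+1) = l0 * hilbert R a (L + m.+1) + w0 * per]]%N.
Proof.
have cS : #|{: S}| = N by rewrite /N /nb_vertices cardfE.
have := @walk_periodicity {: S} edge weight (fun L => hilbert R a (L + m.+1)) start_rank m.+1.
rewrite cS; apply.
- exact: start_rank_le.
- by move=> u v /asboolP[y [_ <- _]]; exact: start_rank_gt0.
- move=> u [//|v p] pp _.
  (* A vertex is not assumed to be the cell of a window; the first edge provides one. *)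
  have [y [_ yu _]] : exists y, [/\ mintwice a y, state y = u & state (behead_seq y) = v].
    by move: pp => /= /andP[/asboolP].
  rewrite -yu in pp *; have [z [sz _ rz]] := sat_of_walk pp.
  exact: leq_trans rz (rk_hilbert sz).
- move=> L; have [z sz hz] := hilbert_rk (sat_exists L).
  have [p [p1 p2 _ p4]] := walk_of_sat sz.
  exists (state z), p; split=> //; rewrite hz; apply/eqP; rewrite eqn_leq.
  rewrite (leq_trans p4) ?leq_add2r ?start_rank_ge //=.
  have [z' [sz' _ rz']] := sat_of_walk p1; rewrite -hz -p2.
  exact: leq_trans rz' (rk_hilbert sz').
Qed.

End Graph.

(** * The number of vertices *)

Lemma same_diff_small (R : realType) (x x' : R) : -1 < x -> x < 1 -> -1 < x' -> x' < 1 ->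
  (x < 0) = (x' < 0) -> (0 < x) = (0 < x') -> same_diff x x'.
Proof.
move=> h1 h2 h3 h4 e1 e2; apply: same_diffP => c.
  have [c1|[c1|->]] : 1 <= c \/ (c <= -1 \/ c = 0) by lia.
  - have : 1 <= c%:~R :> R by rewrite -[1]/(1%:~R) ler_int.
    by move=> c1'; rewrite !(lt_le_trans _ c1').
  - have : c%:~R <= -1 :> R by rewrite -[-1]/((-1)%:~R) ler_int.
    by move=> c1'; rewrite !ltNge !(le_trans c1') // ltW.
  - exact: e1.
have [c1|[c1|->]] : 1 <= c \/ (c <= -1 \/ c = 0) by lia.
- have : 1 <= c%:~R :> R by rewrite -[1]/(1%:~R) ler_int.
  by move=> c1'; rewrite !(le_trans _ c1') // ltW.
- have : c%:~R <= -1 :> R by rewrite -[-1]/((-1)%:~R) ler_int.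
  by move=> c1'; rewrite !leNgt !(le_lt_trans c1').
- by rewrite !leNgt e2.
Qed.

Section Count.
Variables (R : realType) (m : nat) (a : 'I_m.+2 -> int).
Local Notation T := ({set 'I_m.+1} * 'I_m.+1 * 'M[int]_m.+1 * 'M[bool]_m.+1)%type.
Local Notation M := (absz (amplitude a)).
Local Notation poly_of v := (vertex_polyhedron R a v.1.1.1 v.1.1.2 v.1.2 v.2).

Definition gap (s : 'I_m.+1) (y : 'rV[R]_m.+1) (j : 'I_m.+1) : R := y 0 j - y 0 s.

Definition frac s y j : R := gap s y j - (Num.floor (gap s y j))%:~R.

Definition frac_rank (B : {set 'I_m.+1}) s y j : nat :=
  #|[set i in B | frac s y i < frac s y j]%SET|.

Lemma frac_itv s y j : 0 <= frac s y j < 1.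
Proof.
rewrite /frac; have := floor_le (gap s y j); have := floorD1_gt (gap s y j).
rewrite rmorphD /= => h1 h2; apply/andP; split; lra.
Qed.

Lemma frac_rank_lt (B : {set 'I_m.+1}) s y r l : r \in B -> l \in B ->
  (frac s y r < frac s y l) = (frac_rank B s y r < frac_rank B s y l)%N.
Proof.
move=> rB lB; have [lt|le] := ltP (frac s y r) (frac s y l); apply/esym.
  apply: proper_card; apply/properP; split.
    by apply/fintype.subsetP => i; rewrite !inE => /andP[-> h]; exact: lt_trans h lt.
  by exists r; rewrite !inE rB ?lt // ltxx.
apply/negbTE; rewrite -leqNgt; apply: subset_leq_card; apply/fintype.subsetP => i.
by rewrite !inE => /andP[-> h]; exact: lt_le_trans h le.
Qed.

(** A difference of entries is an integer given by the floors plus a difference of fractional parts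
    in (-1, 1), of which only the sign matters. *)
Lemma same_diff_code (B : {set 'I_m.+1}) s y y' r l : r \in B -> l \in B ->
  (forall j, j \in B -> Num.floor (gap s y j) = Num.floor (gap s y' j)) ->
  (forall j, j \in B -> frac_rank B s y j = frac_rank B s y' j) ->
  same_diff (y 0 r - y 0 l) (y' 0 r - y' 0 l).
Proof.
move=> rB lB hf hr.
have E (x : 'rV[R]_m.+1) : x 0 r - x 0 l = (frac s x r - frac s x l) +
    (Num.floor (gap s x r) - Num.floor (gap s x l))%:~R.
  by rewrite rmorphB /= /frac /gap; ring.
rewrite !E !hf //; apply: same_diff_addr.
have /andP[? ?] := frac_itv s y r; have /andP[? ?] := frac_itv s y l.
have /andP[? ?] := frac_itv s y' r; have /andP[? ?] := frac_itv s y' l.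
apply: same_diff_small; try lra.
  by rewrite !subr_lt0 !(frac_rank_lt _ _ rB lB) !hr.
by rewrite !subr_gt0 !(frac_rank_lt _ _ lB rB) !hr.
Qed.

Lemma vertex_floor (v : T) y : vertices R a v -> poly_of v y ->
  forall j, j \in v.1.1.1 -> 0 <= Num.floor (gap v.1.1.2 y j) <= (2 * m.+1 * M)%:Z.
Proof.
case: v => [[[B s] mm] e] [/= sB _ [h1 h2 _] _ _] [y1 y2 y3 _] j jB.
have M0 := amplitude_ge0 a; have := h1 j jB; have := h2 j jB => {h1 h2}.
set A := amplitude a in M0 * => h2 h1.
have AE : (absz A)%:Z = A by rewrite gez0_abs.
rewrite floor_ge_int subr_ge0 y1 /= -ltzD1 floor_lt_int /gap.
have mA : m.+1%:Z * A + 1 <= (2 * m.+1 * absz A)%:Z + 1.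
  by rewrite !PoszM AE lerD2r ler_wpM2r //; lia.
case: (ltngtP j s) => [js|sj|/val_inj ->]; last first.
- rewrite subrr -[0]/(0%:~R) ltr_int; lia.
- have {}h1 := h1 sj; apply: (@lt_le_trans _ _ (m.+1%:Z * A + 1)%:~R); last by rewrite ler_int.
  have : - (mm s j)%:~R <= (m.+1%:Z * A)%:~R :> R.
    rewrite -rmorphN ler_int; lia.
  rewrite rmorphD /=; case eE : (e s j).
    have := y3 s j sB jB sj eE => /andP[u1 u2]; lra.
  have := y2 s j sB jB sj eE; lra.
have {}h2 := h2 js; apply: (@lt_le_trans _ _ (mm j s + 1)%:~R).
  rewrite rmorphD /=; case eE : (e j s).
    have := y3 j s jB sB js eE => /andP[u1 u2]; lra.
  have := y2 j s jB sB js eE; lra.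
rewrite ler_int lerD2r (le_trans h2) // !PoszM AE ler_wpM2r //.
have := ltn_ord s; lia.
Qed.

Lemma vertex_data (v : T) y r l : poly_of v y ->
  r \in v.1.1.1 -> l \in v.1.1.1 -> (r < l)%N ->
  v.1.2 r l = Num.floor (y 0 r - y 0 l) /\ v.2 r l = (y 0 r - y 0 l \isn't a Num.int).
Proof.
case: v => [[[B s] mm] e] /= [_ y2 y3 _] rB lB rl; case eE : (e r l).
  have /andP[u1 u2] := y3 r l rB lB rl eE.
  have v1 : (mm r l)%:~R < y 0 r - y 0 l by lra.
  have v2 : y 0 r - y 0 l < (mm r l + 1)%:~R by rewrite rmorphD /=; lra.
  by split; [apply/esym/floor_def; rewrite (ltW v1) | rewrite (not_int_between v1 v2)].
have -> : y 0 r - y 0 l = (mm r l)%:~R by rewrite (y2 r l) //; lra.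
by rewrite intrKfloor intr_int.
Qed.

Local Notation code_type := ('I_m.+1 * {ffun 'I_m.+1 -> option 'I_(2 * m.+1 * M).+1} *
  {ffun 'I_m.+1 -> 'I_m.+2})%type.

(** [None] marks the indices outside [B], so the code also records [B]. The default point 0 occurs
    only for empty polyhedra, hence for no vertex. *)
Definition code (v : T) : code_type :=
  let y := if pselect (exists y, poly_of v y) is left h then projT1 (cid h) else 0 in
  let B := v.1.1.1 in let s := v.1.1.2 in
  (s, [ffun j => if j \in B then Some (inord (absz (Num.floor (gap s y j)))) else None],
      [ffun j => inord (frac_rank B s y j)]).

Lemma code_inj (v v' : T) : vertices R a v -> vertices R a v' -> code v = code v' -> v = v'.
Proof.
move=> hv hv'; rewrite /code.
case: pselect => [h|[]]; last by have [_ _ _ [y hy] _] := hv; exists y.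
case: cid => /= y hy {h}.
case: pselect => [h|[]]; last by have [_ _ _ [y' hy'] _] := hv'; exists y'.
case: cid => /= y' hy' {h} [es ef er].
have eB : v.1.1.1 = v'.1.1.1.
  by apply/setP => j; move/ffunP/(_ j): ef; rewrite !ffunE; do 2 case: ifP.
have hf j : j \in v.1.1.1 -> Num.floor (gap v.1.1.2 y j) = Num.floor (gap v.1.1.2 y' j).
  move=> jB; move/ffunP/(_ j): ef; rewrite !ffunE -eB jB => -[] /(congr1 val) /=.
  have := vertex_floor hv hy jB; rewrite eB in jB; have := vertex_floor hv' hy' jB.
  by rewrite -es => /andP[? ?] /andP[? ?]; rewrite !inordK; lia.
have hr j : j \in v.1.1.1 -> frac_rank v.1.1.1 v.1.1.2 y j = frac_rank v.1.1.1 v.1.1.2 y' j.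
  move=> jB; move/ffunP/(_ j): er; rewrite !ffunE => /(congr1 val) /=.
  rewrite -es -eB !inordK // ltnS (leq_trans (max_card _)) ?card_ord //.
case: v v' hv hv' hy hy' es eB hf hr {ef er} => [[[B s] mm] e] [[[B' s'] mm'] e'] /=.
move=> hv hv' hy hy' es eB hf hr; move: hv hv' hy hy'; rewrite -{}es -{}eB => hv hv' hy hy'.
have [_ c1 _ _ _] := hv; have [_ c2 _ _ _] := hv'.
have H r l : mm r l = mm' r l /\ e r l = e' r l.
  have [/and3P[rB lB rl]|nrl] := boolP [&& r \in B, l \in B & (r < l)%N]; last first.
    by have [-> ->] := c1 _ _ nrl; have [-> ->] := c2 _ _ nrl.
  have [/= -> ->] := @vertex_data (B, s, mm, e) _ _ _ hy rB lB rl.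
  have [/= -> ->] := @vertex_data (B, s, mm', e') _ _ _ hy' rB lB rl.
  by have [-> ->] := same_diff_code rB lB hf hr.
by congr (_, _, _, _); apply/matrixP => r l; have [] := H r l.
Qed.

Lemma nb_vertices_le :
  (nb_vertices R a <= (16 * maxn M 1 * m.+1 ^ 2) ^ m.+1)%N.
Proof.
rewrite /nb_vertices cardfE.
have inj : injective (fun v : fset_set (vertices R a) => code (val v)).
  move=> v v' /code_inj h; apply/val_inj/h.
    by have := fsvalP v; rewrite in_fset_set ?inE //; exact: vertices_finite.
  by have := fsvalP v'; rewrite in_fset_set ?inE //; exact: vertices_finite.
have := leq_card _ inj; rewrite !card_prod !card_ffun card_option !card_ord => /leq_trans; apply.
set X := maxn M 1; have X1 : (1 <= X)%N by rewrite leq_maxr.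
have MX : (M <= X)%N by rewrite leq_maxl.
have h1 : ((2 * m.+1 * M).+2 ^ m.+1 <= (4 * m.+1 * X) ^ m.+1)%N.
  rewrite leq_exp2r //.
  have : (2 * m.+1 * M <= 2 * m.+1 * X)%N by rewrite leq_mul2l MX orbT.
  have : (1 * 1 <= m.+1 * X)%N by apply: leq_mul.
  lia.
have h2 : (m.+2 ^ m.+1 <= (2 * m.+1) ^ m.+1)%N by rewrite leq_exp2r //; lia.
have h3 : (m.+1 <= 2 ^ m.+1)%N by rewrite ltnW // ltn_expl.
apply: leq_trans (leq_mul (leq_mul h3 h1) h2) _.
by rewrite -!expnMn leq_exp2r //; nia.
Qed.

End Count.

(** * The size of the period *)

Lemma hilbert_n0 (R : realType) (a : 'I_1 -> int) k : hilbert R a k = 0%N.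
Proof.
apply/eqP; rewrite -leqn0; apply/bigop.bigmax_leqP => c /forallP cc.
apply/bigop.bigmax_leqP => d _; case: k c cc d => [|k] c cc d.
  by rewrite -ltnS ltn_ord.
have k0 : (0 < k.+1 - 0)%N by [].
by have := cc (Ordinal k0); rewrite !ord1 eqxx.
Qed.

Lemma sqrt_up X : (0 < X)%N -> exists2 t, (0 < t)%N & (X <= t ^ 2 <= 2 * X)%N.
Proof.
move=> X0; have exP : exists t, (X <= t ^ 2)%N by exists X; rewrite -{1}[X]expn1 leq_pexp2l.
case: (ex_minnP exP) => -[|t] Xt tmin; first by lia.
have lt : (t ^ 2 < X)%N by rewrite ltnNge; apply/negP => /tmin; rewrite ltnn.
exists t.+1 => //; rewrite Xt /=; move: lt; rewrite !expnS !expn0 !muln1; nia.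
Qed.

(** [t * t ^ n <= (t ^ 2) ^ n] turns the square roots back into [X]. The constants collect to 512 =
    16 * 4 * 2 * 4 inside the power, and doubling it gives strictness. *)
Lemma period_exponent t X n : (0 < n)%N -> (0 < t)%N -> (0 < X)%N -> (t ^ 2 <= 2 * X)%N ->
  (2 * (4 * t * n) * n * (2 * (4 * t * n) ^ n) < (1024 * X * n) ^ n)%N.
Proof.
move=> n0 t0 X0 tX.
have n2 : (n <= 2 ^ n)%N by rewrite ltnW // ltn_expl.
have t2 : (t * t ^ n <= (2 * X) ^ n)%N.
  apply: leq_trans (_ : (t ^ 2) ^ n <= _)%N; last by rewrite leq_exp2r.
  by rewrite -expnS -expnM leq_pexp2l //; lia.
have h16 : (16 <= 16 ^ n)%N by rewrite -{1}[16%N]expn1 leq_pexp2l.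
have -> : (2 * (4 * t * n) * n * (2 * (4 * t * n) ^ n) =
    16 * (n * n) * (t * t ^ n) * (4 ^ n * n ^ n))%N by rewrite !expnMn; ring.
apply: leq_ltn_trans (_ : (512 * X * n) ^ n < _)%N; last first.
  by rewrite ltn_exp2r // !ltn_mul2r n0 X0.
apply: leq_trans (_ : 16 ^ n * (2 ^ n * 2 ^ n) * (2 * X) ^ n * (4 ^ n * n ^ n) <= _)%N.
  by rewrite leq_mul // leq_mul // leq_mul // leq_mul.
by rewrite -!expnMn leq_exp2r //; apply: eq_leq; ring.
Qed.

Lemma period_lt (R : realType) (m V X per : nat) : (0 < X)%N ->
  (V <= (16 * X * m.+1 ^ 2) ^ m.+1)%N ->
  (forall K, V <= K ^ 2 -> 0 < K -> per <= V.+1 ^ (2 * K))%N ->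
  per%:R < expR ((1024 * X%:R * m.+1%:R) ^+ m.+1) :> R.
Proof.
move=> X0 hV hper; have [t t0 /andP[Xt tX]] := sqrt_up X0.
(* Since [X <= t ^ 2], [b ^ 2] bounds [16 * X * m.+1 ^ 2], and [b ^ m.+1] serves as the integer [K]
   with [V <= K ^ 2]. *)
pose b := (4 * t * m.+1)%N.
have hVb : (V <= (b ^ m.+1) ^ 2)%N.
  apply: leq_trans hV _; rewrite expnAC leq_exp2r // /b !expnMn.
  by rewrite leq_mul // leq_mul.
have K0 : (0 < b ^ m.+1)%N by rewrite expn_gt0 /b !muln_gt0 t0.
have hV1 : (V.+1 <= (b.+1 ^ 2) ^ m.+1)%N.
  apply: leq_ltn_trans hVb _; rewrite expnAC ltn_exp2r //.
  by rewrite ltn_exp2r.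
have eV : V.+1%:R <= expR ((2 * b * m.+1)%:R : R).
  apply: le_trans (_ : ((b.+1 ^ 2) ^ m.+1)%:R <= _); first by rewrite ler_nat.
  rewrite -expnM natrX [(2 * b * _)%N]mulnAC natrM expRM_natl.
  by rewrite lerXn2r ?nnegrE ?expR_ge0 // -natr1 addrC expR_ge1Dx.
apply: (@le_lt_trans _ _ ((V.+1 ^ (2 * b ^ m.+1))%:R)); first by rewrite ler_nat hper.
rewrite natrX; apply: (@le_lt_trans _ _ (expR ((2 * b * m.+1)%:R : R) ^+ (2 * b ^ m.+1))).
  by rewrite lerXn2r ?nnegrE ?expR_ge0.
rewrite -expRM_natl ltr_expR -natrM.
rewrite (_ : 1024 * X%:R * _ = (1024 * X * m.+1)%:R); last by rewrite !natrM.
by rewrite -natrX ltr_nat mulnC; exact: period_exponent.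
Qed.

(** * Entropy, threshold and conclusion *)

Lemma hilbert_cvg (R : realType) (h : nat -> nat) (n l0 w0 C : nat) : (0 < l0)%N ->
  (forall L, 0 < L -> w0 * L <= l0 * h (L + n) <= w0 * L + C)%N ->
  (fun k => (h k)%:R / k%:R : R) @ \oo --> (w0%:R / l0%:R : R).
Proof.
move=> l0_gt0 hh; apply/cvgrPdist_lt => e e0; near=> k.
have kn : (n < k)%N by near: k; exact: nbhs_infty_gt.
have kD : (w0 * n + C)%:R / e < k%:R :> R by near: k; exact: nbhs_infty_gtr.
have := hh (k - n)%N; rewrite subn_gt0 subnK ?(ltnW kn) // => /(_ kn).
rewrite mulnBr => hk.
have k0 : 0 < k%:R :> R by rewrite ltr0n (leq_ltn_trans _ kn).
have l0R : 0 < l0%:R :> R by rewrite ltr0n.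
have -> : w0%:R / l0%:R - (h k)%:R / k%:R = ((w0 * k)%:R - (l0 * h k)%:R) / (l0%:R * k%:R) :> R.
  by rewrite !natrM; field; rewrite !gt_eqF.
rewrite normrM normfV (gtr0_norm (mulr_gt0 l0R k0)) ltr_pdivrMr ?mulr_gt0 //.
rewrite ltr_pdivrMr // in kD.
apply: (@le_lt_trans _ _ (w0 * n + C)%:R).
  have w1 : (w0 * n <= w0 * k)%N by rewrite leq_mul2l ltnW ?orbT.
  have r1 : (l0 * h k)%:R <= (w0 * k + (w0 * n + C))%:R :> R by rewrite ler_nat; lia.
  have r2 : (w0 * k)%:R <= (l0 * h k + (w0 * n + C))%:R :> R by rewrite ler_nat; lia.
  by rewrite natrD in r1; rewrite natrD in r2; rewrite ler_norml; apply/andP; split; lra.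
apply: lt_le_trans kD _; rewrite mulrC mulrA; apply: ler_wpM2r; first exact: ltW.
by rewrite ler_peMr ?(ltW e0) // ler1n.
Unshelve. all: by end_near. Qed.

(** Bounding [(1 - H) * V] below by 0 leaves an integer threshold, which still exceeds both bounds
    on walk lengths after the [n] initial entries are subtracted. *)
Lemma threshold_nat (R : realType) (V n k : nat) (H : R) : (0 < n)%N -> 0 <= H <= 1 ->
  ((V%:R : R) ^+ 2 + 1) * (V%:R + n%:R) + V%:R * ((1 - H) * V%:R + n%:R + 1) ^+ 2 < k%:R ->
  exists2 L, k = (L + n)%N & (4 * V ^ 2 <= L)%N /\ (V ^ 2 * (V + n) < L)%N.
Proof.
move=> n0 /andP[H0 H1] hk.
have {hk} : ((V ^ 2 + 1) * (V + n) + V * (n + 1) ^ 2 < k)%N.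
  rewrite -(ltr_nat R); apply: le_lt_trans hk.
  rewrite !(natrD, natrM, natrX) lerD2l ler_wpM2l // ler_sqr ?nnegrE; last first.
  - by rewrite !addr_ge0 // mulr_ge0 // subr_ge0.
  - by rewrite addr_ge0.
  by rewrite -addrA lerDr mulr_ge0 // subr_ge0.
rewrite mulnDl mul1n !expnS !expn0 !muln1 => hk.
exists (k - n)%N; first by lia.
by split; nia.
Qed.

Theorem theorem5p4 (R : realType) :
  exists C : R, 0 < C /\
  forall (n : nat) (a : 'I_n.+1 -> int),
    let M := amplitude a in
    let H := entropy R a in
    let V := (nb_vertices R a)%:R : R in
    exists p : nat,
      [/\ (0 < p)%N,
          (p%:R : R) < expR ((C * (Num.max M 1)%:~R * n%:R) ^+ n)
        & forall k : nat,
            (V ^+ 2 + 1) * (V + n%:R) + V * ((1 - H) * V + n%:R + 1) ^+ 2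
              < k%:R ->
            (hilbert R a (k + p))%:R = (hilbert R a k)%:R + H * p%:R].
Proof.
exists 1024; split=> // -[|m] a M H V.
  have -> : H = 0.
    rewrite /H /entropy; apply: (cvg_lim (@Rhausdorff R)).
    by under eq_fun do rewrite hilbert_n0 mul0r; exact: cvg_cst.
  (* For [n = 0] the exponent is an empty power, so the bound reads [1 < expR 1]. *)
  exists 1%N; split=> // [|k _]; first by rewrite expr0 expR_gt1.
  by rewrite !hilbert_n0 mul0r addr0.
have [l0 [w0 [per [l0_gt0 w0_le per_gt0 [hper hlim hstep]]]]] := hilbert_periodicity R a.
have HE : H = w0%:R / l0%:R.
  by apply: (cvg_lim (@Rhausdorff R)); exact: hilbert_cvg l0_gt0 hlim.
have H01 : 0 <= H <= 1.
  by rewrite HE divr_ge0 //= ler_pdivrMr ?ltr0n // mul1r ler_nat.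
exists per; split=> // [|k /threshold_nat[//|//|L -> [L1 L2]]].
  have -> : (Num.max M 1)%:~R = (maxn (absz (amplitude a)) 1)%:R :> R.
    have -> : Num.max M 1 = (maxn (absz (amplitude a)) 1)%:Z.
      by have := amplitude_ge0 a; rewrite /M; lia.
    by [].
  by apply: (period_lt R _ (nb_vertices_le R a) hper); rewrite leq_maxr.
have l0R : l0%:R != 0 :> R by rewrite pnatr_eq0 -lt0n.
have := hstep L L1 L2; rewrite addnAC => /(congr1 (fun x : nat => x%:R : R)).
rewrite natrD !natrM => e; apply: (mulfI l0R); rewrite e HE mulrDr; congr +%R.
by field.
Qed.
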